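(* Let $U = k[[X, Y, Z]]$ be the formal power series ring over a field $k$, let $\mathfrak{a}$ be the ideal of $U$ generated by the $2\times 2$-minors of the matrix $\begin{pmatrix} X & Y & Z \\ Y & Z & X\end{pmatrix}$, and set $A = U/\mathfrak{a}$. Then the following assertions hold true. (1) If $k$ has characteristic $3$, then $A$ is not an Arf ring. (2) If the characteristic of $k$ is not $3$ and there exists $\alpha \in k$ such that $\alpha \ne 1$ and $\alpha^3 =1$, then $A$ is an Arf ring.
   Context: The ring $A$ is a one-dimensional Cohen-Macaulay local ring. For a commutative ring $A$, $Q(A)$ denotes its total ring of fractions. A Noetherian semi-local ring $A$ such that $A_M$ is a one-dimensional Cohen-Macaulay local ring for every maximal ideal $M$ is called an Arf ring if: (1) every integrally closed ideal $I$ of $A$ containing a non-zerodivisor on $A$ has a principal reduction, i.e., $I^{n+1}=aI^n$ for some $n\ge 0$ and $a\in I$; and (2) if $x,y,z\in A$ are such that $x$ is a non-zerodivisor on $A$ and $y/x, z/x\in Q(A)$ are integral over $A$, then $yz/x\in A$. *)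

(* Defs.v *)
From HB Require Import structures.
From mathcomp Require Import all_boot all_order all_algebra.
From mathcomp Require Import ring.
From mathcomp Require Export mpoly.
From mathcomp Require Export boolp classical_sets cardinality.

Set Implicit Arguments.
Unset Strict Implicit.
Unset Printing Implicit Defensive.

Import GRing.Theory.

Local Open Scope ring_scope.
Local Open Scope classical_set_scope.
Local Open Scope quotient_scope.

(* Formal power series R[[X_0, ..., X_(n-1)]]: arbitrary families of           *)
(* coefficients indexed by multi-exponents, with the Cauchy product.          *)
Section PowerSeries.
Variables (n : nat) (R : comNzRingType).

Record fps := Fps { fcoef : 'X_{1..n} -> R }.

Implicit Types (f g h : fps) (m : 'X_{1..n}).

Lemma fpsP f g : fcoef f =1 fcoef g -> f = g.
Proof. by case: f g => f [g] /= /funext ->. Qed.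

HB.instance Definition _ := gen_eqMixin fps.
HB.instance Definition _ := gen_choiceMixin fps.

Definition fps_zero := Fps (fun=> 0).
Definition fps_opp f := Fps (fun m => - fcoef f m).
Definition fps_add f g := Fps (fun m => fcoef f m + fcoef g m).
Definition fps_const (c : R) := Fps (fun m => c *+ (m == 0%MM)).
Definition fps_one := fps_const 1.
Definition fps_var (i : 'I_n) := Fps (fun m => (m == U_(i)%MM)%:R).
(* The index type only makes the sum over all decompositions m = k.1 + k.2    *)
(* range over a finite type; it leaves out none of them.                      *)
Definition fps_mul f g := Fps (fun m =>
  \sum_(k : 'X_{1..n < (mdeg m).+1, (mdeg m).+1} | m == (k.1 + k.2)%MM)
     fcoef f k.1 * fcoef g k.2).

Let trunc d f : {mpoly R[n]} := \sum_(m : 'X_{1..n < d}) fcoef f m *: 'X_[m].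

Let truncE d f m : (mdeg m < d)%N -> (trunc d f)@_m = fcoef f m.
Proof. exact: (mcoeff_mpoly (fcoef f)). Qed.

Let poly_mul_coef (p q : {mpoly R[n]}) f g m :
  (forall k, (mdeg k <= mdeg m)%N -> p@_k = fcoef f k) ->
  (forall k, (mdeg k <= mdeg m)%N -> q@_k = fcoef g k) ->
  (p * q)@_m = fcoef (fps_mul f g) m.
Proof.
move=> Hp Hq; rewrite mcoeffM; apply: eq_bigr => k _.
by congr (_ * _); [apply: Hp|apply: Hq]; rewrite -ltnS; apply: bmdeg.
Qed.

Let trunc_mul d f g m : (mdeg m < d)%N ->
  fcoef (fps_mul f g) m = (trunc d f * trunc d g)@_m.
Proof.
by move=> Hm; rewrite (poly_mul_coef (f := f) (g := g)) // => k Hk;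
  rewrite truncE // (leq_ltn_trans Hk).
Qed.

Fact fps_addA : associative fps_add.
Proof. by move=> f g h; apply: fpsP => m /=; rewrite addrA. Qed.
Fact fps_addC : commutative fps_add.
Proof. by move=> f g; apply: fpsP => m /=; rewrite addrC. Qed.
Fact fps_add0 : left_id fps_zero fps_add.
Proof. by move=> f; apply: fpsP => m /=; rewrite add0r. Qed.
Fact fps_addN : left_inverse fps_zero fps_opp fps_add.
Proof. by move=> f; apply: fpsP => m /=; rewrite addNr. Qed.

HB.instance Definition _ :=
  GRing.isZmodule.Build fps fps_addA fps_addC fps_add0 fps_addN.

Fact fps_mulA : associative fps_mul.
Proof.
move=> f g h; apply: fpsP => m; pose d := (mdeg m).+1.
rewrite -(poly_mul_coef (p := trunc d f) (q := trunc d g * trunc d h)); last 2 first.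
- by move=> k Hk; rewrite truncE.
- by move=> k Hk; rewrite -trunc_mul.
rewrite -(poly_mul_coef (p := trunc d f * trunc d g) (q := trunc d h)); last 2 first.
- by move=> k Hk; rewrite -trunc_mul.
- by move=> k Hk; rewrite truncE.
by rewrite mulrA.
Qed.

Fact fps_mulC : commutative fps_mul.
Proof.
move=> f g; apply: fpsP => m.
by rewrite !(trunc_mul (d := (mdeg m).+1)) // mulrC.
Qed.

Fact fps_mul1 : left_id fps_one fps_mul.
Proof.
move=> f; apply: fpsP => m.
rewrite -(poly_mul_coef (p := 1) (q := trunc (mdeg m).+1 f)) => [|k Hk|k Hk].
- by rewrite mul1r truncE.
- by rewrite mcoeff1.
- by rewrite truncE.
Qed.

Fact fps_mulD : left_distributive fps_mul fps_add.
Proof.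
move=> f g h; apply: fpsP => m /=; rewrite -big_split /=.
by apply: eq_bigr => k _; rewrite mulrDl.
Qed.

Fact fps_one_neq0 : fps_one != 0.
Proof.
apply/eqP => /(congr1 (fun f => fcoef f 0%MM)) /= /eqP.
by rewrite eqxx oner_eq0.
Qed.

HB.instance Definition _ := GRing.Zmodule_isComNzRing.Build fps
  fps_mulA fps_mulC fps_mul1 fps_mulD fps_one_neq0.

Lemma fcoef0M f g : fcoef (f * g) 0%MM = fcoef f 0%MM * fcoef g 0%MM.
Proof.
rewrite (trunc_mul (d := 1)) ?mdeg0 //.
by rewrite (rmorphM (mcoeff (0%MM : 'X_{1..n}))) /= !truncE ?mdeg0.
Qed.

End PowerSeries.

Section Ideals.
Variable R : comNzRingType.
Implicit Types (I J S : set R) (x : R) (s : seq R).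

Definition is_ideal I :=
  [/\ I 0, forall x y, I x -> I y -> I (x + y) & forall a x, I x -> I (a * x)].

Definition ideal_gen S : set R :=
  [set x | forall I, is_ideal I -> S `<=` I -> I x].

Definition ideal_mul I J : set R :=
  ideal_gen [set z | exists x y, [/\ I x, J y & z = x * y]].

Definition ideal_exp I n : set R := iter n (ideal_mul I) setT.

Definition is_prime I :=
  [/\ is_ideal I, ~ I 1 & forall x y, I (x * y) -> I x \/ I y].

Definition is_maximal I :=
  [/\ is_ideal I, ~ I 1 & forall J, is_ideal J -> ~ J 1 -> I `<=` J -> J = I].

Definition noetherian :=
  forall I, is_ideal I -> exists s, I = ideal_gen [set` s].

Definition semilocal := finite_set [set M : set R | is_maximal M].

Definition is_local := exists M, is_maximal M /\ forall N, is_maximal N -> N = M.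

Definition prime_chain n :=
  exists P : 'I_n.+1 -> set R,
    (forall i, is_prime (P i)) /\ (forall i j : 'I_n.+1, (i < j)%N -> P i `<` P j).

Definition krull_dim_eq d :=
  prime_chain d /\ forall n, prime_chain n -> (n <= d)%N.

(* x_1, ..., x_r is regular when each x_(i+1) is a non-zerodivisor on         *)
(* R / (x_1, ..., x_i) and R / (x_1, ..., x_r) is nonzero.                    *)
Definition regular_seq s :=
  (forall i, (i < size s)%N -> forall a,
     ideal_gen [set` take i s] (s`_i * a) -> ideal_gen [set` take i s] a)
  /\ ~ ideal_gen [set` s] 1.

Definition regular_seq_in I s := (forall x, x \in s -> I x) /\ regular_seq s.

Definition depth_eq I d :=
  (exists2 s, size s = d & regular_seq_in I s) /\
  forall s, regular_seq_in I s -> (size s <= d)%N.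

Definition cm_local :=
  [/\ noetherian, is_local &
      exists d, krull_dim_eq d /\ forall M, is_maximal M -> depth_eq M d].

Definition cm_local_dim1 := cm_local /\ krull_dim_eq 1.

(* x^n + c_1 x^(n-1) + ... + c_n = 0 with n > 0 and c_i in I^i.               *)
Definition ideal_integral I x :=
  exists n (c : nat -> R),
    [/\ (0 < n)%N, forall i, (1 <= i <= n)%N -> ideal_exp I i (c i) &
        x ^+ n + \sum_(1 <= i < n.+1) c i * x ^+ (n - i) = 0].

Definition integrally_closed_ideal I :=
  is_ideal I /\ forall x, ideal_integral I x -> I x.

Definition has_principal_reduction I :=
  exists n a, I a /\ ideal_exp I n.+1 = [set a * x | x in ideal_exp I n].

Lemma ideal_gen_ideal S : is_ideal (ideal_gen S).
Proof.
split=> [I [] //|x y Hx Hy I HI HS|a x Hx I HI HS]; have [_ D M] := HI.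
  by apply: D; [apply: Hx|apply: Hy].
by apply: M; apply: Hx.
Qed.

Lemma sub_ideal_gen S : S `<=` ideal_gen S.
Proof. by move=> x Sx I _; apply. Qed.

Lemma maximal_prime I : is_maximal I -> is_prime I.
Proof.
move=> [HI I1 Imax]; split=> // x y Ixy; have [I0 ID IM] := HI.
apply: contrapT => /not_orP [nIx nIy].
pose J : set R := [set z | exists i a, I i /\ z = i + a * x].
have HJ : is_ideal J.
  split.
  - by exists 0, 0; rewrite mul0r addr0.
  - move=> _ _ [i [a [Ii ->]]] [j [b [Ij ->]]].
    by exists (i + j), (a + b); split; [apply: ID|rewrite mulrDl addrACA].
  - move=> c _ [i [a [Ii ->]]].
    by exists (c * i), (c * a); split; [apply: IM|rewrite mulrDr mulrA].
have [[i [a [Ii E]]]|nJ1] := pselect (J 1).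
  apply: nIy; rewrite -[y]mul1r E mulrDl; apply: ID.
    by rewrite mulrC; apply: IM.
  by rewrite -mulrA; apply: IM.
apply: nIx; rewrite -(Imax J HJ nJ1); last by move=> i Ii; exists i, 0; rewrite mul0r addr0.
by exists 0, 1; rewrite mul1r add0r.
Qed.

Record mulset := MulSet {
  mulset_set :> set R;
  mulset_one : mulset_set 1;
  mulset_mul : forall x y, mulset_set x -> mulset_set y -> mulset_set (x * y);
  mulset_zero : ~ mulset_set 0
}.

Definition prime_compl I (pI : is_prime I) : mulset.
Proof.
refine (@MulSet (~` I) _ _ _); case: pI => [[I0 _ _] I1 IM].
- exact: I1.
- by move=> x y nx ny /IM [].
- by move/(_ I0).
Defined.

Definition nzd_mulset : mulset.
Proof.
refine (@MulSet [set x : R | GRing.lreg x] _ _ _) => [|x y|/=].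
- exact: lreg1.
- exact: lregM.
- by move/lreg_neq0; rewrite eqxx.
Defined.

End Ideals.
Arguments noetherian : clear implicits.
Arguments semilocal : clear implicits.
Arguments is_local : clear implicits.
Arguments krull_dim_eq : clear implicits.
Arguments cm_local : clear implicits.
Arguments cm_local_dim1 : clear implicits.
Arguments nzd_mulset : clear implicits.

(* S^-1 R, for a multiplicative set S that does not contain 0.                *)
Section Localization.
Variables (R : comNzRingType) (S : mulset R).

Let dom := (R * set_type S)%type.
Implicit Types x y z : dom.

Definition loc_equiv x y := `[< exists2 u, mulset_set S u &
  u * (x.1 * sval y.2) = u * (y.1 * sval x.2) >].

Fact loc_equiv_refl : reflexive loc_equiv.
Proof. by move=> x; apply/asboolP; exists 1; [exact: mulset_one|]. Qed.

Fact loc_equiv_sym : ssrbool.symmetric loc_equiv.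
Proof.
by move=> x y; apply/asboolP/asboolP => -[u Su E]; exists u => //; rewrite E.
Qed.

Let SP (s : set_type S) : mulset_set S (sval s). Proof. exact: (set_mem (proj2_sig s)). Qed.

Fact loc_equiv_trans : transitive loc_equiv.
Proof.
move=> [b t] [a s] [c r] /asboolP [u Su /= E] /asboolP [v Sv /= F].
apply/asboolP => /=; exists (u * v * sval t).
  by apply: mulset_mul; [apply: mulset_mul|apply: SP].
transitivity (v * sval r * (u * (a * sval t))); first by ring.
transitivity (u * sval s * (v * (b * sval r))); first by rewrite E; ring.
by rewrite F; ring.
Qed.

Canonical loc_equiv_equiv :=
  EquivRel loc_equiv loc_equiv_refl loc_equiv_sym loc_equiv_trans.

Definition loc := {eq_quot loc_equiv}.

HB.instance Definition _ : EqQuotient _ loc_equiv loc := EqQuotient.on loc.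
HB.instance Definition _ := Choice.on loc.

Definition loc_frac (a : R) (s : set_type S) : loc := \pi_loc (a, s).

Lemma loc_fracP a s b t : loc_frac a s = loc_frac b t <->
  exists2 u, mulset_set S u & u * (a * sval t) = u * (b * sval s).
Proof. by split=> [/eqmodP/asboolP|H]; last exact/eqmodP/asboolP. Qed.

Lemma loc_fracW (P : loc -> Prop) :
  (forall a s, P (loc_frac a s)) -> forall x : loc, P x.
Proof. by move=> H; elim/quotW=> -[a s]; apply: H. Qed.

Let one_sub : set_type S := SigSub (mem_set (mulset_one S)).
Let mul_sub (s t : set_type S) : set_type S :=
  SigSub (mem_set (mulset_mul (SP s) (SP t))).

Definition to_loc (a : R) : loc := loc_frac a one_sub.

Definition loc_add (x y : loc) : loc :=
  let: (a, s) := repr x in let: (b, t) := repr y in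
  loc_frac (a * sval t + b * sval s) (mul_sub s t).
Definition loc_opp (x : loc) : loc :=
  let: (a, s) := repr x in loc_frac (- a) s.
Definition loc_mul (x y : loc) : loc :=
  let: (a, s) := repr x in let: (b, t) := repr y in
  loc_frac (a * b) (mul_sub s t).

Let repr_frac a s : exists2 u, mulset_set S u &
  u * ((repr (loc_frac a s)).1 * sval s) = u * (a * sval (repr (loc_frac a s)).2).
Proof.
have : loc_frac (repr (loc_frac a s)).1 (repr (loc_frac a s)).2 = loc_frac a s.
  by rewrite {1}/loc_frac -surjective_pairing reprK.
by move/loc_fracP.
Qed.

Lemma loc_addE a s b t : loc_add (loc_frac a s) (loc_frac b t) =
  loc_frac (a * sval t + b * sval s) (mul_sub s t).
Proof.
rewrite /loc_add; have := repr_frac b t; have := repr_frac a s.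
case: (repr _) => a' s'; case: (repr _) => b' t' [u Su /= E] [v Sv /= F].
apply/loc_fracP; exists (u * v); first exact: mulset_mul.
rewrite /=.
transitivity (v * sval t * sval t' * (u * (a' * sval s)) +
              u * sval s * sval s' * (v * (b' * sval t))); first by ring.
by rewrite E F; ring.
Qed.

Lemma loc_oppE a s : loc_opp (loc_frac a s) = loc_frac (- a) s.
Proof.
rewrite /loc_opp; have := repr_frac a s.
case: (repr _) => a' s' [u Su /= E]; apply/loc_fracP; exists u => //.
by rewrite !mulNr !mulrN E.
Qed.

Lemma loc_mulE a s b t :
  loc_mul (loc_frac a s) (loc_frac b t) = loc_frac (a * b) (mul_sub s t).
Proof.
rewrite /loc_mul; have := repr_frac b t; have := repr_frac a s.
case: (repr _) => a' s'; case: (repr _) => b' t' [u Su /= E] [v Sv /= F].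
apply/loc_fracP; exists (u * v); first exact: mulset_mul.
rewrite /=.
transitivity ((u * (a' * sval s)) * (v * (b' * sval t))); first by ring.
by rewrite E F; ring.
Qed.

Let loc_eq a s b t : a * sval t = b * sval s -> loc_frac a s = loc_frac b t.
Proof. by move=> E; apply/loc_fracP; exists 1; rewrite ?E //; apply: mulset_one. Qed.

Fact loc_addA : associative loc_add.
Proof.
elim/loc_fracW=> a s; elim/loc_fracW=> b t; elim/loc_fracW=> c r.
by rewrite !loc_addE; apply: loc_eq => /=; ring.
Qed.
Fact loc_addC : commutative loc_add.
Proof.
elim/loc_fracW=> a s; elim/loc_fracW=> b t.
by rewrite !loc_addE; apply: loc_eq => /=; ring.
Qed.
Fact loc_add0 : left_id (to_loc 0) loc_add.
Proof. by elim/loc_fracW=> a s; rewrite loc_addE; apply: loc_eq => /=; ring. Qed.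
Fact loc_addN : left_inverse (to_loc 0) loc_opp loc_add.
Proof.
by elim/loc_fracW=> a s; rewrite loc_oppE loc_addE; apply: loc_eq => /=; ring.
Qed.

HB.instance Definition _ :=
  GRing.isZmodule.Build loc loc_addA loc_addC loc_add0 loc_addN.

Fact loc_mulA : associative loc_mul.
Proof.
elim/loc_fracW=> a s; elim/loc_fracW=> b t; elim/loc_fracW=> c r.
by rewrite !loc_mulE; apply: loc_eq => /=; ring.
Qed.
Fact loc_mulC : commutative loc_mul.
Proof.
elim/loc_fracW=> a s; elim/loc_fracW=> b t.
by rewrite !loc_mulE; apply: loc_eq => /=; ring.
Qed.
Fact loc_mul1 : left_id (to_loc 1) loc_mul.
Proof. by elim/loc_fracW=> a s; rewrite loc_mulE; apply: loc_eq => /=; ring. Qed.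
Fact loc_mulD : left_distributive loc_mul loc_add.
Proof.
elim/loc_fracW=> a s; elim/loc_fracW=> b t; elim/loc_fracW=> c r.
by rewrite !(loc_addE, loc_mulE); apply: loc_eq => /=; ring.
Qed.
Fact loc_one_neq0 : to_loc 1 != to_loc 0.
Proof.
apply/eqP => /loc_fracP [u Su /=]; rewrite !mul1r mul0r mulr0 mulr1 => E.
by apply: (@mulset_zero _ S); rewrite -E.
Qed.

HB.instance Definition _ := GRing.Zmodule_isComNzRing.Build loc
  loc_mulA loc_mulC loc_mul1 loc_mulD loc_one_neq0.

Fact to_loc_zmod_morphism : zmod_morphism to_loc.
Proof.
move=> a b; rewrite -[RHS]/(loc_add _ (loc_opp _)) loc_oppE loc_addE.
by apply: loc_eq => /=; ring.
Qed.
Fact to_loc_monoid_morphism : monoid_morphism to_loc.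
Proof.
by split=> // a b; rewrite -[RHS]/(loc_mul _ _) loc_mulE; apply: loc_eq => /=; ring.
Qed.

HB.instance Definition _ :=
  GRing.isZmodMorphism.Build R loc to_loc to_loc_zmod_morphism.
HB.instance Definition _ :=
  GRing.isMonoidMorphism.Build R loc to_loc to_loc_monoid_morphism.

End Localization.

Definition loc_max (R : comNzRingType) (M : set R) (hM : is_maximal M) :
  comNzRingType :=
  loc (prime_compl (maximal_prime hM)).

(* The total ring of fractions Q(R): all non-zerodivisors are inverted.       *)
Definition total_frac (R : comNzRingType) : comNzRingType := loc (nzd_mulset R).

(* The fraction y / x of Q(R), for x a non-zerodivisor.                       *)
Definition tfrac (R : comNzRingType) (y x : R) (hx : GRing.lreg x) : total_frac R :=
  loc_frac y (SigSub (mem_set (hx : mulset_set (nzd_mulset R) x))).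

Definition to_total_frac (R : comNzRingType) :
  R -> total_frac R := @to_loc R (nzd_mulset R).

HB.instance Definition _ (R : comNzRingType) :=
  GRing.RMorphism.copy (@to_total_frac R) (@to_loc R (nzd_mulset R)).

Lemma tfracK (R : comNzRingType) (y x : R) (hx : GRing.lreg x) :
  tfrac y hx * to_total_frac x = to_total_frac y.
Proof.
rewrite -[LHS]/(loc_mul _ _) /tfrac /to_total_frac /to_loc loc_mulE.
apply/loc_fracP; exists 1; first exact: mulset_one.
by rewrite /=; ring.
Qed.

Record arf (R : comNzRingType) : Prop := Arf {
  arf_noetherian : noetherian R;
  arf_semilocal : semilocal R;
  arf_cm_dim1 : forall (M : set R) (hM : is_maximal M), cm_local_dim1 (loc_max hM);
  arf_reduction : forall I : set R, integrally_closed_ideal I ->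
    (exists2 x, I x & GRing.lreg x) -> has_principal_reduction I;
  arf_stable : forall (x y z : R) (hx : GRing.lreg x),
    integralOver (@to_total_frac R) (tfrac y hx) ->
    integralOver (@to_total_frac R) (tfrac z hx) ->
    exists w, tfrac (y * z) hx = to_total_frac w
}.

(* The r x r minors, over increasing choices of r rows and r columns.         *)
Definition minors (R : comNzRingType) (r m n : nat) (B : 'M[R]_(m, n)) : set R :=
  [set d | exists (f : 'I_r -> 'I_m) (g : 'I_r -> 'I_n),
     [/\ {homo f : i j / (i < j)%N}, {homo g : i j / (i < j)%N} &
         d = \det (mxsub f g B)]].

Lemma det_mx2 (R : comNzRingType) (B : 'M[R]_2) :
  \det B = B 0 0 * B 1 1 - B 0 1 * B 1 0.
Proof.
rewrite (expand_det_row _ ord0) !big_ord_recl big_ord0 addr0 /cofactor !det_mx11.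
rewrite !mxE /= expr0 expr1 mul1r mulN1r mulrN.
by congr (B _ _ * B _ _ - B _ _ * B _ _); apply: val_inj.
Qed.

Section MinorsRing.
Variable k : fieldType.

Definition serU : comNzRingType := fps 3 k.
Definition varX : serU := fps_var k (@Ordinal 3 0 isT).
Definition varY : serU := fps_var k (@Ordinal 3 1 isT).
Definition varZ : serU := fps_var k (@Ordinal 3 2 isT).

Definition matXYZ : 'M[serU]_(2, 3) :=
  \matrix_(i, j) nth 0 (nth [::] [:: [:: varX; varY; varZ]; [:: varY; varZ; varX]] i) j.

Definition minors_ideal : set serU := ideal_gen (minors 2 matXYZ).

Definition in_minors_ideal : serU -> bool := fun f => f \in minors_ideal.

Fact minors_ideal_proper : ~ minors_ideal 1.
Proof.
pose m : set serU := [set f | fcoef f 0%MM = 0].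
have Hm : is_ideal m.
  split=> [//|f g|f g Hg]; first by rewrite /m /= => -> ->; rewrite addr0.
  by apply: etrans (fcoef0M f g) _; rewrite [fcoef g _]Hg mulr0.
have var0 i : m (fps_var k i).
  rewrite /m /=; case: eqP => // /(congr1 (fun u : 'X_{1..3} => u i)).
  by rewrite mnm0E mnm1E eqxx.
have ent i j : m (matXYZ i j).
  by rewrite mxE; case: i j => [[|[|?]] // ?] [[|[|[|?]]] // ?]; apply: var0.
move/(_ m Hm); suff H : minors 2 matXYZ `<=` m.
  by move/(_ H); rewrite /m /= eqxx => /eqP; rewrite oner_eq0.
have [m0 mD mM] := Hm.
move=> _ [f [g [_ _ ->]]]; rewrite det_mx2 ![mxsub _ _ _ _ _]mxE; apply: mD.
  by apply: mM; apply: ent.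
by rewrite -mulNr; apply: mM; apply: ent.
Qed.

Fact minors_ideal_closed : idealr_closed in_minors_ideal.
Proof.
have [I0 ID IM] := ideal_gen_ideal (minors 2 matXYZ).
split.
- exact/mem_set.
- by apply/negP => /set_mem; apply: minors_ideal_proper.
- move=> a u v /set_mem Iu /set_mem Iv; apply/mem_set.
  by apply: ID => //; apply: IM.
Qed.

HB.instance Definition _ := isIdealr.Build serU in_minors_ideal minors_ideal_closed.

Definition minors_idealr : idealr serU := in_minors_ideal.

Definition ringA : comNzRingType := {ideal_quot minors_idealr}.

End MinorsRing.

(* Main.v *)
From HB Require Import structures.
Require Import Defs.
From mathcomp Require Import all_boot all_order all_algebra.
From mathcomp Require Import ring.

Set Implicit Arguments.
Unset Strict Implicit.
Unset Printing Implicit Defensive.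

Import GRing.Theory.
Local Open Scope ring_scope.
Local Open Scope classical_set_scope.

(** The ideal a defines the cone over the scheme of cube roots of unity. Indeed
    in A one has M^2 = X M for the maximal ideal M = (X, Y, Z), because Y^2 = XZ,
    YZ = X^2 and Z^2 = XY; hence A is generated over k[[X]] by 1, Y, Z
    ([minors_division]). On the other hand X |-> T, Y |-> y T, Z |-> y^2 T maps U to
    power series in T over k[y]/(y^3 - 1) and kills a. The images of 1, Y, Z are
    independent over k[[T]], so that a is exactly the kernel of this map
    ([minors_idealE]). All questions about A become questions about the quotient
    k[y]/(y^3 - 1).

    In characteristic 3 we have y^3 - 1 = (y - 1)^3, and the fraction (X - Y) / X^2
    is nilpotent, hence integral over A. If A were Arf, then (X - Y)^2 would be a
    multiple of X^2 in A; in the coefficient of T^2 this says that (1 - y)^2 is a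
    constant modulo y^3 - 1, which is absurd ([ringA_pchar3]).

    If k contains three distinct cube roots of unity 1, alpha, alpha^2, then
    evaluating y at them identifies A with the ring of triples of power series
    with a common constant term ([ringA_is_axes]), that is, with the local ring of
    three coordinate axes in general position. Such a ring, with any positive
    number of axes, is Arf ([axes_arf]). It is noetherian because each of
    its restrictions to an axis is a map onto the principal ideal ring k[[T]]. It is
    local, and already equal to its localization. It has dimension and depth 1
    because every non-zerodivisor divides a power of the diagonal element
    (T, ..., T). Finally both Arf conditions are checked axis by axis, using that
    k[[T]] is a discrete valuation ring and that a family of power series without
    constant terms always belongs to the ring. *)

(** * Power series in one variable *)

Section Series.
Variable R : comNzRingType.

Record series := Series { scoef : nat -> R }.
Implicit Types f g h : series.

Lemma seriesP f g : scoef f =1 scoef g -> f = g.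
Proof. by case: f g => f [g] /= /funext ->. Qed.

HB.instance Definition _ := gen_eqMixin series.
HB.instance Definition _ := gen_choiceMixin series.

Definition series_zero := Series (fun=> 0).
Definition series_one := Series (fun n => (n == 0)%:R).
Definition series_opp f := Series (fun n => - scoef f n).
Definition series_add f g := Series (fun n => scoef f n + scoef g n).
Definition series_mul f g :=
  Series (fun n => \sum_(i < n.+1) scoef f i * scoef g (n - i)).

Let trunc d f := \poly_(i < d) scoef f i.

Let series_mulE d f g n : (n < d)%N ->
  scoef (series_mul f g) n = (trunc d f * trunc d g)`_n.
Proof.
move=> lt_nd; rewrite coefM; apply: eq_bigr => i _.
rewrite !coef_poly (leq_ltn_trans (leq_subr i n) lt_nd).
by rewrite (leq_ltn_trans _ lt_nd) // -ltnS.
Qed.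

Fact series_addA : associative series_add.
Proof. by move=> f g h; apply: seriesP => n /=; rewrite addrA. Qed.
Fact series_addC : commutative series_add.
Proof. by move=> f g; apply: seriesP => n /=; rewrite addrC. Qed.
Fact series_add0 : left_id series_zero series_add.
Proof. by move=> f; apply: seriesP => n /=; rewrite add0r. Qed.
Fact series_addN : left_inverse series_zero series_opp series_add.
Proof. by move=> f; apply: seriesP => n /=; rewrite addNr. Qed.

HB.instance Definition _ := GRing.isZmodule.Build series
  series_addA series_addC series_add0 series_addN.

Fact series_mulA : associative series_mul.
Proof.
move=> f g h; apply: seriesP => n; pose d := n.+1.
have trM u v (p : {poly R}) :
    (trunc d (series_mul u v) * p)`_n = (trunc d u * trunc d v * p)`_n.
  rewrite !coefM; apply: eq_bigr => i _; congr (_ * _).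
  have lt_i : (i < d)%N := ltn_ord i.
  by rewrite -(series_mulE _ _ lt_i) coef_poly lt_i.
rewrite (series_mulE (d := d)) // [RHS](series_mulE (d := d)) //.
by rewrite mulrC !trM mulrC mulrA.
Qed.

Fact series_mulC : commutative series_mul.
Proof.
by move=> f g; apply: seriesP => n; rewrite !(series_mulE (d := n.+1)) // mulrC.
Qed.

Fact series_mul1 : left_id series_one series_mul.
Proof.
move=> f; apply: seriesP => n /=; rewrite big_ord_recl /= mul1r subn0.
by rewrite big1 ?addr0 // => i _; rewrite /= mul0r.
Qed.

Fact series_mulD : left_distributive series_mul series_add.
Proof.
move=> f g h; apply: seriesP => n /=; rewrite -big_split /=.
by apply: eq_bigr => i _; rewrite mulrDl.
Qed.

Fact series_one_neq0 : series_one != series_zero.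
Proof.
by apply/eqP => /(congr1 (fun f => scoef f 0)) /= /eqP; rewrite oner_eq0.
Qed.

HB.instance Definition _ := GRing.Zmodule_isComNzRing.Build series
  series_mulA series_mulC series_mul1 series_mulD series_one_neq0.

Lemma scoefD f g n : scoef (f + g) n = scoef f n + scoef g n. Proof. by []. Qed.
Lemma scoefN f n : scoef (- f) n = - scoef f n. Proof. by []. Qed.
Lemma scoef1 n : scoef (1 : series) n = (n == 0)%:R. Proof. by []. Qed.
Lemma scoefM f g n :
  scoef (f * g) n = \sum_(i < n.+1) scoef f i * scoef g (n - i).
Proof. by []. Qed.

Lemma scoef0M f g : scoef (f * g) 0 = scoef f 0 * scoef g 0.
Proof. by rewrite scoefM big_ord1. Qed.

Definition serT : series := Series (fun n => (n == 1)%:R).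

Definition series_const (c : R) : series := Series (fun n => c *+ (n == 0)).

Lemma scoefC c n : scoef (series_const c) n = c *+ (n == 0).
Proof. by []. Qed.

Definition series_shift f : series := Series (fun n => scoef f n.+1).

Lemma scoefTM f n : scoef (serT * f) n = if n is m.+1 then scoef f m else 0.
Proof.
case: n => [|n]; first by rewrite scoef0M mul0r.
rewrite scoefM big_ord_recl mul0r add0r big_ord_recl /= mul1r subn1.
by rewrite big1 ?addr0 // => i _; rewrite mul0r.
Qed.

Lemma scoefCM c f n : scoef (series_const c * f) n = c * scoef f n.
Proof.
rewrite scoefM big_ord_recl /= subn0 big1 ?addr0 // => i _.
by rewrite mul0r.
Qed.

Lemma series_constM c d : series_const (c * d) = series_const c * series_const d.
Proof. by apply: seriesP => n; rewrite scoefCM !scoefC mulrnAr. Qed.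

Lemma series_constB c d : series_const (c - d) = series_const c - series_const d.
Proof. by apply: seriesP => n; rewrite scoefD scoefN !scoefC mulrnBl. Qed.

Lemma series_const1 : series_const 1 = 1.
Proof. by apply: seriesP => n; rewrite scoefC. Qed.

Lemma series_shiftK f : scoef f 0 = 0 -> f = serT * series_shift f.
Proof. by move=> f0; apply: seriesP => -[|n]; rewrite scoefTM. Qed.

Lemma serT_lreg : GRing.lreg serT.
Proof.
move=> f g /(congr1 scoef) E; apply: seriesP => n.
by have := congr1 (@^~ n.+1) E; rewrite !scoefTM.
Qed.

End Series.

Arguments serT {R}.

Section SeriesMap.
Variables (R S : comNzRingType) (h : {rmorphism R -> S}).

Definition series_map (f : series R) : series S := Series (fun n => h (scoef f n)).

Fact series_map_zmod_morphism : zmod_morphism series_map.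
Proof. by move=> f g; apply: seriesP => n /=; rewrite rmorphB. Qed.
Fact series_map_monoid_morphism : monoid_morphism series_map.
Proof.
split=> [|f g]; apply: seriesP => n /=; first by rewrite rmorph_nat.
by rewrite rmorph_sum; apply: eq_bigr => i _; rewrite rmorphM.
Qed.
HB.instance Definition _ := GRing.isZmodMorphism.Build (series R) (series S)
  series_map series_map_zmod_morphism.
HB.instance Definition _ := GRing.isMonoidMorphism.Build (series R) (series S)
  series_map series_map_monoid_morphism.

End SeriesMap.

Section SeriesField.
Variable K : fieldType.
Implicit Types f g u : series K.

Lemma series_inv f : scoef f 0 != 0 -> exists g, f * g = 1.
Proof.
move=> nz; pose a := scoef f 0.
(* [s n] lists the first n coefficients of the inverse g, each of which is forced
   by the coefficient of the same degree in f * g = 1. *)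
pose step (s : seq K) := rcons s
  (a^-1 * ((size s == 0)%:R - \sum_(i < size s) scoef f (size s - i) * s`_i)).
pose s n := iter n step [::].
have sz n : size (s n) = n by elim: n => //= n IH; rewrite size_rcons IH.
pose g := Series (fun n => (s n.+1)`_n).
have nthS n i : (i < n)%N -> (s n)`_i = scoef g i.
  elim: n => // n IH; rewrite ltnS leq_eqVlt => /orP [/eqP-> //|lt_in].
  by rewrite -IH //= /step nth_rcons sz lt_in.
have gE n : a * scoef g n =
    (n == 0)%:R - \sum_(i < n) scoef f (n - i) * (s n)`_i.
  by rewrite /= /step nth_rcons sz ltnn eqxx mulrA mulfV ?mul1r.
exists g; rewrite mulrC; apply: seriesP => n.
rewrite scoefM big_ord_recr subnn [_ * scoef f 0]mulrC gE scoef1.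
rewrite /= [_%:R - _]addrC addrA -[RHS]add0r; congr (_ + _).
apply/eqP; rewrite subr_eq0; apply/eqP/eq_bigr => i _.
by rewrite nthS // mulrC.
Qed.

(** The exponent d is the order of f: k[[T]] is a discrete valuation ring with
    parameter T. *)
Lemma series_factor f : f != 0 -> exists d u, f = serT ^+ d * u /\ scoef u 0 != 0.
Proof.
move=> nz; have ex : exists n, scoef f n != 0.
  apply: contrapT => no; case/eqP: nz; apply: seriesP => n.
  by apply/eqP/negPn/negP => nz; apply: no; exists n.
case: (ex_minnP ex) => d nzd min.
exists d, (Series (fun n => scoef f (n + d))); split=> //.
elim: d {nzd ex} f min {nz} => [|d IH] f min.
  by apply: seriesP => n; rewrite expr0 mul1r /= addn0.
rewrite {1}[f]series_shiftK; last first.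
  by apply/eqP/negPn/negP => /min.
rewrite {1}[series_shift f]IH; last by move=> n /min.
rewrite exprS -mulrA; congr (_ * (_ * _)); apply: seriesP => n /=.
by rewrite addnS.
Qed.

Lemma series_mul_eq0 f g : f * g = 0 -> f = 0 \/ g = 0.
Proof.
move=> fg0; have [->|nf] := eqVneq f 0; [by left|right].
have [d [u [Ef /series_inv [v uv]]]] := series_factor nf.
have : serT ^+ d * g = 0.
  transitivity (f * g * v); last by rewrite fg0 mul0r.
  by rewrite {}Ef -[LHS]mulr1 -uv; ring.
elim: d {Ef} => [|d IH]; first by rewrite expr0 mul1r.
by rewrite exprS -mulrA => H; apply: IH; apply: serT_lreg; rewrite H mulr0.
Qed.

Lemma series_lreg f : f != 0 -> GRing.lreg f.
Proof.
move=> nf g h /eqP; rewrite -subr_eq0 -mulrBr => /eqP /series_mul_eq0 [|/eqP].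
  by move/eqP; rewrite (negbTE nf).
by rewrite subr_eq0 => /eqP.
Qed.

Lemma series_expf_eq0 f n : f ^+ n = 0 -> f = 0.
Proof.
elim: n => [|n IH]; last by rewrite exprS => /series_mul_eq0 [|/IH].
by rewrite expr0 => /eqP; rewrite oner_eq0.
Qed.

(** Compare the orders of f and g. *)
Lemma series_dvd_total f g : (exists h, g = f * h) \/ (exists h, f = g * (serT * h)).
Proof.
have [->|nf] := eqVneq f 0; first by right; exists 0; rewrite !mulr0.
have [->|ng] := eqVneq g 0; first by left; exists 0; rewrite mulr0.
have [d [u [-> /series_inv [u' uu']]]] := series_factor nf.
have [e [v [-> /series_inv [v' vv']]]] := series_factor ng.
have [le_de|lt_ed] := leqP d e.
  left; exists (u' * serT ^+ (e - d) * v).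
  rewrite -{1}(subnKC le_de) exprD -[in LHS](mulr1 (serT ^+ d)) -uu'.
  by ring.
right; exists (v' * serT ^+ (d - e.+1) * u).
rewrite -{1}(subnKC lt_ed) exprD exprSr -[in LHS](mulr1 (serT ^+ e)) -vv'.
by ring.
Qed.

(** Any set of series contains an element dividing all the others: one of least
    order. *)
Lemma series_least (J : set (series K)) : (exists f, J f) ->
  exists2 b, J b & forall f, J f -> exists g, f = b * g.
Proof.
move=> [f0 Jf0].
have [[f Jf nf]|all0] := pselect (exists2 f, J f & f != 0); last first.
  exists f0 => // f Jf; exists 0; rewrite mulr0; apply/eqP/negPn/negP => nf.
  by apply: all0; exists f.
pose P d := `[< exists2 f, J f & scoef f d != 0 >].
have ex : exists d, P d.
  have [d [u [E nu]]] := series_factor nf; exists d; apply/asboolP; exists f => //.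
  rewrite E; suff -> : scoef (serT ^+ d * u) d = scoef u 0 by [].
  elim: d {E} => [|d IH]; first by rewrite expr0 mul1r.
  by rewrite exprS -mulrA scoefTM.
case: (ex_minnP ex) => d /asboolP [b Jb nb] min; exists b => // g Jg.
have [//|[h E]] := series_dvd_total b g.
(* Otherwise b = g T h, and g would have a nonzero coefficient below d. *)
have g0 i : (i < d)%N -> scoef g i = 0.
  move=> lt_id; apply/eqP/negPn/negP => ng.
  by have /min : P i; [apply/asboolP; exists g | rewrite leqNgt lt_id].
case/eqP: nb; rewrite E mulrCA; case: (d) g0 => [|e] g0; rewrite scoefTM //.
by rewrite scoefM big1 // => i _; rewrite g0 ?mul0r.
Qed.

End SeriesField.

(** * Generalities on ideals and isomorphisms *)

Section IdealFacts.
Variable R : comNzRingType.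
Implicit Types (I J P : set R) (x y : R) (s : seq R).

Lemma ideal_gen_sub (S : set R) I : is_ideal I -> S `<=` I -> ideal_gen S `<=` I.
Proof. by move=> HI SI x; apply. Qed.

Lemma ideal0 I : is_ideal I -> I 0.
Proof. by case. Qed.

Lemma idealB I x y : is_ideal I -> I x -> I y -> I (x - y).
Proof. by case=> _ ID IM Ix Iy; apply: ID => //; rewrite -mulN1r; apply: IM. Qed.

Lemma ideal_mulr I x y : is_ideal I -> I x -> I (x * y).
Proof. by case=> _ _ IM Ix; rewrite mulrC; apply: IM. Qed.

Lemma ideal_genP s x : ideal_gen [set` s] x -> forall I, is_ideal I ->
  (forall y, y \in s -> I y) -> I x.
Proof. by move=> H I HI sI; apply: H. Qed.

Lemma ideal_gen0P x : ideal_gen [set` ([::] : seq R)] x -> x = 0.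
Proof.
move=> H; apply: (ideal_genP H (I := [set 0])) => //.
by split=> //= [_ _ -> ->|a _ ->]; rewrite ?addr0 ?mulr0.
Qed.

Lemma ideal_gen1P y x : ideal_gen [set` [:: y]] x -> exists a, x = a * y.
Proof.
move=> H; apply: (ideal_genP H (I := [set z | exists a, z = a * y])).
  split=> [|_ _ [a ->] [b ->]|c _ [a ->]] /=; first by exists 0; rewrite mul0r.
    by exists (a + b); rewrite mulrDl.
  by exists (c * a); rewrite mulrA.
by move=> z; rewrite inE => /eqP ->; exists 1; rewrite mul1r.
Qed.

Lemma ideal_mulP I J x y : I x -> J y -> ideal_mul I J (x * y).
Proof. by move=> Ix Jy; apply: sub_ideal_gen; exists x, y. Qed.

Lemma ideal_exp1 I : is_ideal I -> ideal_exp I 1 = I.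
Proof.
move=> HI; apply/seteqP; split=> [|x Ix]; last first.
  by rewrite -[x]mulr1; apply: ideal_mulP.
by apply: ideal_gen_sub => // _ [x [y [Ix _ ->]]]; apply: ideal_mulr.
Qed.

Lemma prime_exp P x n : is_prime P -> P (x ^+ n) -> P x.
Proof.
move=> [_ P1 PM]; elim: n => [//|n IH].
by rewrite exprS => /PM [].
Qed.

End IdealFacts.

Lemma rmorph_inverse (R S : comNzRingType) (f : {rmorphism R -> S}) :
  bijective f -> exists2 g : {rmorphism S -> R}, cancel f g & cancel g f.
Proof.
case=> g fK gK.
pose gA := GRing.isZmodMorphism.Build S R g (can2_zmod_morphism fK gK).
pose gM := GRing.isMonoidMorphism.Build S R g (can2_monoid_morphism fK gK).
pose h : {rmorphism S -> R} := HB.pack g gA gM.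
by exists h.
Qed.

(** * Rings of coordinate axes *)

(** The local ring at the origin of a union of [n.+1] coordinate axes, described
    by the restrictions to the axes rather than by equations: it is the ring of
    families of power series with a common constant term. *)
Record is_axes (K : fieldType) (n : nat) (R : comNzRingType)
    (chi : 'I_n.+1 -> {rmorphism R -> series K}) : Prop := IsAxes {
  axes_inj : forall x y, (forall i, chi i x = chi i y) -> x = y;
  axes_const : forall x i j, scoef (chi i x) 0 = scoef (chi j x) 0;
  axes_glue : forall g : 'I_n.+1 -> series K,
    (forall i j, scoef (g i) 0 = scoef (g j) 0) ->
    exists x, forall i, chi i x = g i }.

Lemma is_axes_iso (K : fieldType) (n : nat) (R S : comNzRingType)
    (chi : 'I_n.+1 -> {rmorphism R -> series K}) (f : {rmorphism R -> S}) :
  is_axes chi -> bijective f ->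
  exists chi' : 'I_n.+1 -> {rmorphism S -> series K}, is_axes chi'.
Proof.
move=> H /rmorph_inverse [g fK gK]; exists (fun i => chi i \o g).
split=> [x y E|x i j|h Eh]; last 1 first.
- have [x Ex] := axes_glue H Eh; exists (f x) => i; by rewrite /= fK.
- by apply: (can_inj gK); apply: (axes_inj H) => i; apply: E.
- exact: (axes_const H).
Qed.

Section Axes.
Variables (K : fieldType) (n : nat) (R : comNzRingType).
Variable chi : 'I_n.+1 -> {rmorphism R -> series K}.
Hypothesis axesR : is_axes chi.
Implicit Types (x y : R) (f : series K) (i j : 'I_n.+1).

Definition origin_ideal : set R := [set x | scoef (chi ord0 x) 0 = 0].
Local Notation m := origin_ideal.

Lemma origin_coef x i : m x -> scoef (chi i x) 0 = 0.
Proof. by move=> <-; apply: (axes_const axesR). Qed.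

Lemma origin_idealP : is_ideal m.
Proof.
split=> [|x y|a x]; rewrite /m /= ?rmorph0 //.
  by rewrite rmorphD scoefD => -> ->; rewrite addr0.
by rewrite rmorphM scoef0M => ->; rewrite mulr0.
Qed.

Lemma origin_proper : ~ m 1.
Proof. by rewrite /m /= rmorph1 scoef1; apply/eqP/oner_neq0. Qed.

Lemma axes_unit x : ~ m x -> exists y, x * y = 1.
Proof.
move=> nx.
have /choice [g Eg] i : exists g, chi i x * g = 1.
  by apply: series_inv; apply/eqP; rewrite (axes_const axesR _ i ord0).
have [|y Ey] := axes_glue axesR (g := g); last first.
  by exists y; apply: (axes_inj axesR) => i; rewrite rmorphM rmorph1 Ey Eg.
have mulc i : scoef (chi ord0 x) 0 * scoef (g i) 0 = 1.
  by rewrite (axes_const axesR x ord0 i) -scoef0M Eg.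
move=> i j; have nz : scoef (chi ord0 x) 0 != 0 by apply/eqP.
by apply: (mulfI nz); rewrite !mulc.
Qed.

Lemma proper_sub_origin (I : set R) : is_ideal I -> ~ I 1 -> I `<=` m.
Proof.
move=> HI I1 x Ix; apply: contrapT => /axes_unit [y xy].
by apply: I1; rewrite -xy; apply: ideal_mulr.
Qed.

Lemma origin_maximal : is_maximal m.
Proof.
split; [exact: origin_idealP|exact: origin_proper|].
move=> J HJ J1 mJ; apply/seteqP; split=> //; exact: proper_sub_origin.
Qed.

Lemma maximal_origin (M : set R) : is_maximal M -> M = m.
Proof.
move=> [HM M1 Mmax]; symmetry; apply: Mmax; first exact: origin_idealP.
  exact: origin_proper.
exact: proper_sub_origin.
Qed.

Lemma glue_origin (g : 'I_n.+1 -> series K) : (forall i, scoef (g i) 0 = 0) ->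
  exists2 x, m x & forall i, chi i x = g i.
Proof.
move=> g0; have [|x Ex] := axes_glue axesR (g := g); first by move=> i j; rewrite !g0.
by exists x => //; rewrite /m /= Ex.
Qed.

Lemma diag_element f : exists x, forall i, chi i x = f.
Proof. exact: (axes_glue axesR (g := fun=> f)). Qed.

Lemma axis_element i f : scoef f 0 = 0 ->
  exists x, forall j, chi j x = if j == i then f else 0.
Proof.
move=> f0; have [|x _ Ex] := @glue_origin (fun j => if j == i then f else 0).
  by move=> j; case: eqP.
by exists x.
Qed.

Lemma serT_neq0 : (serT : series K) != 0.
Proof.
by apply/eqP => /(congr1 (fun f => scoef f 1)) /= /eqP; rewrite oner_eq0.
Qed.

Lemma axes_lregP x : GRing.lreg x <-> forall i, chi i x != 0.
Proof.
split=> [rx i|nz y z E]; last first.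
  apply: (axes_inj axesR) => i; apply: (series_lreg (nz i)).
  by rewrite -!rmorphM E.
have [e Ee] : exists e, forall j, chi j e = if j == i then serT else 0.
  exact: axis_element.
apply/eqP => x0; have e0 : e = 0.
  apply: rx; rewrite mulr0; apply: (axes_inj axesR) => j.
  by rewrite rmorphM rmorph0 Ee; case: eqP => [->|_]; rewrite ?x0 ?mul0r ?mulr0.
by have := Ee i; rewrite e0 rmorph0 eqxx => /eqP; rewrite eq_sym (negbTE serT_neq0).
Qed.

(** Filter an ideal by the number of initial axes on which its elements vanish.
    Each successive quotient embeds into the principal ideal ring k[[T]], and
    every restriction to an axis is onto, so one generator per axis is enough. *)
Lemma axes_noetherian : noetherian R.
Proof.
move=> I HI; have [I0 ID IM] := HI.
pose N (d : nat) x := I x /\ forall j, (j < d)%N -> chi j x = 0.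
have /choice [b Hb] i : exists b, N i b /\
    forall x, N i x -> exists g, chi i x = chi i b * g.
  have [|_ [b Nb <-] bmin] := @series_least K [set chi i x | x in N i].
    by exists (chi i 0), 0 => //; split=> // j _; rewrite rmorph0.
  by exists b; split=> // x Nx; apply: bmin; exists x.
exists [seq b i | i <- enum 'I_n.+1].
set S := [set` _]; have HS := ideal_gen_ideal S; have [S0 SD SM] := HS.
have bS i : ideal_gen S (b i).
  by apply: sub_ideal_gen; apply/map_f; rewrite mem_enum.
apply/seteqP; split=> [x Ix|]; last first.
  apply: ideal_gen_sub => // _ /mapP [i _ ->]; exact: (Hb i).1.1.
suff: forall d, (d <= n.+1)%N -> N (n.+1 - d)%N x -> ideal_gen S x.
  by move/(_ n.+1 (leqnn _)); apply; rewrite subnn; split.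
move=> d; elim: d x {Ix} => [|d IH] x le_d [Ix x0].
  suff -> : x = 0 by [].
  by apply: (axes_inj axesR) => i; rewrite rmorph0 x0 // subn0.
have lt_i : (n.+1 - d.+1 < n.+1)%N by rewrite subSS ltnS leq_subr.
pose i := Ordinal lt_i.
have [[Ib b0] /(_ x) [|g Eg]] := Hb i; first by split.
have [r Er] := diag_element g.
rewrite -[x](subrK (r * b i)); apply: SD; last exact: SM.
apply: IH (ltnW le_d) _; split; first by apply: idealB => //; apply: IM.
move=> j; rewrite -(subnSK le_d) ltnS leq_eqVlt => /orP [/eqP Ej|lt_j].
  have -> : j = i by apply: val_inj.
  by rewrite rmorphB rmorphM Er Eg mulrC subrr.
by rewrite rmorphB rmorphM x0 // b0 // mulr0 subrr.
Qed.

Lemma axes_local : is_local R.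
Proof. by exists m; split; [exact: origin_maximal|exact: maximal_origin]. Qed.

Lemma axes_semilocal : semilocal R.
Proof.
rewrite /semilocal (_ : [set M | _] = [set m]); first exact: finite_set1.
apply/seteqP; split=> [M|_ ->]; [exact: maximal_origin|exact: origin_maximal].
Qed.

(** The element [t] that restricts to the parameter of every axis is a parameter
    of the ring: it generates m up to radical, and so does every other
    non-zerodivisor of m. *)
Lemma axes_parameter : exists t,
  [/\ m t, GRing.lreg t,
      forall x, m x -> exists y, x ^+ 2 = t * y
    & forall x, GRing.lreg x -> exists N y, t ^+ N = x * y].
Proof.
have [t Et] := diag_element serT; exists t; split.
- by rewrite /m /= Et.
- by apply/axes_lregP => i; rewrite Et serT_neq0.
- move=> x mx; pose h i := series_shift (chi i x).
  have Eh i : chi i x = serT * h i by apply: series_shiftK; apply: origin_coef.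
  have [i|y _ Ey] := @glue_origin (fun i => serT * h i ^+ 2).
    by rewrite scoefTM.
  exists y; apply: (axes_inj axesR) => i.
  by rewrite rmorphXn rmorphM Et Ey Eh; ring.
- move=> x /axes_lregP nz.
  have /choice [d Hd] i : exists d, exists u, serT ^+ d = chi i x * u.
    have [d [u [-> /series_inv [v uv]]]] := series_factor (nz i).
    by exists d, v; rewrite -mulrA uv mulr1.
  have /choice [u Eu] := Hd.
  pose N := (\max_i d i).+1.
  have lt_N i : (d i < N)%N by rewrite ltnS; apply: leq_bigmax.
  have [i|y _ Ey] := @glue_origin (fun i => serT ^+ (N - d i) * u i).
    by rewrite -(subnSK (lt_N i)) exprS -mulrA scoefTM.
  exists N, y; apply: (axes_inj axesR) => i.
  rewrite rmorphXn rmorphM Et Ey mulrCA -Eu -exprD subnK //; exact: ltnW.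
Qed.

Lemma prime_sub_origin P : is_prime P -> P `<=` m.
Proof. by case=> HP P1 _; apply: proper_sub_origin. Qed.

(** Such a Q contains a non-zerodivisor f + g, hence a power of the parameter:
    take f in Q but not in P, and g supported on the axes where f vanishes, so that
    f g = 0 forces g into P. *)
Lemma prime_above_prime P Q : is_prime P -> is_prime Q -> P `<` Q -> Q = m.
Proof.
move=> prP prQ [PQ nQP]; have [t [mt rt sqr pow]] := axes_parameter.
have [HQ _ _] := prQ; have [_ QD QM] := HQ; have [HP _ PM] := prP.
have [f Qf nPf] : exists2 f, Q f & ~ P f.
  by apply: contrapT => no; apply: nQP => f Qf; apply: contrapT => nPf; apply: no; exists f.
have [i|g _ Eg] := @glue_origin (fun i => if chi i f == 0 then serT else 0).
  by case: eqP.
have Qg : Q g.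
  apply: PQ; have /PM [//|//] : P (f * g).
  suff -> : f * g = 0 by case: HP.
  apply: (axes_inj axesR) => i; rewrite rmorphM rmorph0 Eg.
  by case: eqP => [->|_]; rewrite ?mul0r ?mulr0.
have /pow [N [y Ey]] : GRing.lreg (f + g).
  apply/axes_lregP => i; rewrite rmorphD Eg.
  by case: (chi i f =P 0) => [->|/eqP nz]; rewrite ?add0r ?addr0 // serT_neq0.
have Qt : Q t.
  by apply: (prime_exp (n := N)) => //; rewrite Ey; apply: ideal_mulr => //; apply: QD.
apply/seteqP; split=> [|x /sqr [z Ez]]; first exact: prime_sub_origin.
by apply: (prime_exp (n := 2)) => //; rewrite Ez; apply: ideal_mulr.
Qed.

Lemma axes_krull_dim : krull_dim_eq R 1.
Proof.
split.
  pose Q : set R := [set x | chi ord0 x = 0].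
  have prQ : is_prime Q.
    split=> [|/eqP|x y]; rewrite /Q /=.
    - split=> [|x y|a x] /=; rewrite ?rmorph0 // ?rmorphD ?rmorphM => ->.
        by move=> ->; rewrite addr0.
      by rewrite mulr0.
    - by rewrite rmorph1 oner_eq0.
    - by rewrite rmorphM => /series_mul_eq0.
  have prm : is_prime m := maximal_prime origin_maximal.
  exists (fun i : 'I_2 => if i == 0 then Q else m); split.
    by move=> i; case: eqP.
  move=> [[|[|//]] lti] [[|[|//]] ltj] //= _.
  split; first by move=> x; rewrite /Q /m /= => ->.
  have [t [mt /axes_lregP nz _ _]] := axes_parameter.
  by move=> /(_ t mt) /eqP; apply/negP; apply: nz.
move=> d [P [prP ltP]]; rewrite leqNgt; apply/negP => lt1d.
pose i k (lt_k : (k < d.+1)%N) := Ordinal lt_k.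
have l0 : (0 < d.+1)%N by [].
have l1 : (1 < d.+1)%N by apply: ltnW.
have l2 : (2 < d.+1)%N by [].
have E := prime_above_prime (prP (i _ l0)) (prP (i _ l1)) (ltP (i _ l0) (i _ l1) isT).
have [_] := ltP (i _ l1) (i _ l2) isT; rewrite E; apply.
exact: prime_sub_origin.
Qed.

(** Given a non-zerodivisor x of m, every element of m has a power in (x), and so
    cannot be regular modulo x. *)
Lemma axes_depth : depth_eq m 1.
Proof.
have [t [mt rt sqr pow]] := axes_parameter.
split.
  exists [:: t] => //; split; first by move=> x; rewrite inE => /eqP ->.
  split=> [[|//] _ a /= /ideal_gen0P /eqP|/ideal_gen1P [a E]].
    rewrite mulrI_eq0 // => /eqP ->; exact: ideal0 (ideal_gen_ideal _).
  by apply: origin_proper; rewrite E; have [_ _] := origin_idealP; apply.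
move=> [|x [|y s]] // [ms [reg proper]].
have mx : m x by apply: ms; rewrite inE eqxx.
have my : m y by apply: ms; rewrite !inE eqxx orbT.
have rx : GRing.lreg x.
  move=> a b E; apply/eqP; rewrite -subr_eq0; apply/eqP/ideal_gen0P.
  apply: (reg 0%N) => //=; rewrite mulrBr E subrr.
  exact: ideal0 (ideal_gen_ideal _).
have [N [z Ez]] := pow x rx; have [w Ew] := sqr y my.
have HX := ideal_gen_ideal [set` [:: x]].
have : ideal_gen [set` [:: x]] (y ^+ (2 * N)).
  rewrite exprM Ew exprMn Ez -mulrA; apply: (ideal_mulr _ HX).
  by apply: sub_ideal_gen; rewrite /= inE.
have red e : ideal_gen [set` [:: x]] (y ^+ e) -> ideal_gen [set` [:: x]] 1.
  have /= reg1 := reg 1%N isT.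
  by elim: e => // e IH; rewrite exprS => /reg1.
move/red => H; exfalso; apply: origin_proper; apply: H.
  exact: origin_idealP.
by move=> u /=; rewrite inE => /eqP ->.
Qed.

Lemma axes_cm_local_dim1 : cm_local_dim1 R.
Proof.
split; last exact: axes_krull_dim.
split; [exact: axes_noetherian|exact: axes_local|exists 1%N].
split; first exact: axes_krull_dim.
by move=> M /maximal_origin ->; apply: axes_depth.
Qed.

End Axes.

(** * Integral fractions *)

Lemma to_total_frac_inj (R : comNzRingType) : injective (@to_total_frac R).
Proof.
move=> x y /loc_fracP [u ru]; have {}ru : GRing.lreg u by exact: ru.
by rewrite /= !mulr1 => /ru.
Qed.

Lemma tfrac_eq (R : comNzRingType) (x y w : R) (hx : GRing.lreg x) :
  tfrac y hx = to_total_frac w <-> y = x * w.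
Proof.
split=> [|->].
  case/loc_fracP => u ru; have {}ru : GRing.lreg u by exact: ru.
  by rewrite /= mulr1 [w * x]mulrC => /ru.
by apply/loc_fracP; exists 1; [exact: mulset_one|rewrite /= mulr1 [w * x]mulrC].
Qed.

(** Clearing denominators in an equation of integral dependence of y / x. *)
Lemma integral_tfrac (R : comNzRingType) (x y : R) (hx : GRing.lreg x) :
  integralOver (@to_total_frac R) (tfrac y hx) ->
  exists N (c : nat -> R),
    y ^+ N + \sum_(i < N) c i * (y ^+ i * x ^+ (N - i)) = 0.
Proof.
case=> p mon_p; rewrite rootE => /eqP.
have nz_p : (0 < size p)%N by rewrite size_poly_gt0 monic_neq0.
rewrite (horner_coef_wide _ (size_poly _ _)) => E.
exists (size p).-1, (fun i => p`_i); apply: (@to_total_frac_inj R).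
rewrite rmorph0 -(mul0r (to_total_frac x ^+ (size p).-1)) -E mulr_suml.
rewrite -[in RHS](prednK nz_p) big_ord_recr /= [RHS]addrC rmorphD.
congr (_ + _); last first.
  rewrite rmorph_sum; apply: eq_bigr => i _.
rewrite coef_poly ltnS (ltnW (ltn_ord i)) !rmorphM !rmorphXn -mulrA; congr (_ * _).
  rewrite /= -(tfracK y hx) exprMn -mulrA -exprD subnKC //.
  exact: ltnW.
rewrite coef_poly ltnSn -lead_coefE (monicP mon_p) rmorph1 mul1r.
by rewrite rmorphXn /= -(tfracK y hx) exprMn.
Qed.

(** k[[T]] is integrally closed: otherwise x would be a multiple of T y, and the
    equation would read y^N (1 + T w) = 0. *)
Lemma series_integral (K : fieldType) (x y : series K) N (c : nat -> series K) :
  y ^+ N + \sum_(i < N) c i * (y ^+ i * x ^+ (N - i)) = 0 ->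
  exists g, y = x * g.
Proof.
have [//|[h ->]] := series_dvd_total x y; move=> E.
suff -> : y = 0 by exists 0; rewrite mulr0.
have : y ^+ N * (1 + serT * \sum_(i < N) c i * (serT ^+ (N - i).-1 * h ^+ (N - i))) = 0.
  rewrite -[RHS]E mulrDr mulr1; congr (_ + _).
    rewrite mulr_sumr mulr_sumr; apply: eq_bigr => i _.
  have Ei : (N - i)%N = (N - i).-1.+1 by rewrite prednK // subn_gt0.
  have -> : y ^+ N = y ^+ i * y ^+ (N - i) by rewrite -exprD subnKC // ltnW.
  by rewrite Ei /= !exprMn !exprS; ring.
case/series_mul_eq0 => [/series_expf_eq0 //|/(congr1 (fun f => scoef f 0))].
by rewrite scoefD scoefTM scoef1 addr0 => /eqP; rewrite oner_eq0.
Qed.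

(** * Rings of coordinate axes are Arf *)

Section AxesArf.
Variables (K : fieldType) (n : nat) (R : comNzRingType).
Variable chi : 'I_n.+1 -> {rmorphism R -> series K}.
Hypothesis axesR : is_axes chi.
Implicit Types (x y : R) (i j : 'I_n.+1).
Local Notation m := (origin_ideal chi).

Lemma axes_stable x y z (hx : GRing.lreg x) :
  integralOver (@to_total_frac R) (tfrac y hx) ->
  integralOver (@to_total_frac R) (tfrac z hx) ->
  exists w, tfrac (y * z) hx = to_total_frac w.
Proof.
have dvd u : integralOver (@to_total_frac R) (tfrac u hx) ->
    exists g : 'I_n.+1 -> series K, forall i, chi i u = chi i x * g i.
  case/integral_tfrac => N [c E].
  suff /choice [g Eg] : forall i, exists g, chi i u = chi i x * g by exists g.
  move=> i.
  apply: (@series_integral _ _ _ N (fun k => chi i (c k))).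
  rewrite -[RHS](rmorph0 (chi i)) -E rmorphD rmorph_sum rmorphXn; congr (_ + _).
  by apply: eq_bigr => k _; rewrite !rmorphM !rmorphXn.
move=> /dvd [g Eg] /dvd [h Eh].
suff [w Ew] : exists w, y * z = x * w by exists w; apply/tfrac_eq.
have [mx|/(axes_unit axesR) [x' xx']] := pselect (m x); last first.
  by exists (x' * (y * z)); rewrite mulrA xx' mul1r.
have [i|w _ Ew] := glue_origin axesR (g := fun i => chi i x * (g i * h i)).
  by rewrite scoef0M origin_coef ?mul0r.
exists w; apply: (axes_inj axesR) => i.
by rewrite !rmorphM Ew Eg Eh; ring.
Qed.

(** On each axis i choose b_i in I of least order. The element a_i that agrees
    with b_i on the axis i and vanishes on the others satisfies a_i^2 = a_i b_i,
    so it is integral over I. Hence an integrally closed I contained in m contains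
    every family of multiples of the restrictions of a = \sum_i a_i, and a is a
    reduction. *)
Lemma axes_reduction (I : set R) : integrally_closed_ideal I ->
  (exists2 x, I x & GRing.lreg x) -> has_principal_reduction I.
Proof.
move=> [HI closedI] [r Ir regr]; have [I0 ID IM] := HI.
have [I1|/(proper_sub_origin axesR HI) Im] := pselect (I 1).
  exists 0%N, 1; split=> //; rewrite ideal_exp1 //.
  apply/seteqP; split=> x; first by move=> _; exists x; rewrite ?mul1r.
  by move=> _; rewrite -[x]mulr1; apply: IM.
have /choice [b Hb] i : exists b, I b /\
    forall x, I x -> exists g, chi i x = chi i b * g.
  have [|_ [b Ib <-] bmin] := @series_least K [set chi i x | x in I].
    by exists (chi i r), r.
  by exists b; split=> // x Ix; apply: bmin; exists x.
have b0 i : scoef (chi i (b i)) 0 = 0.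
  by apply: origin_coef => //; apply: Im; have [] := Hb i.
have /choice [a Ha] i := axis_element axesR i (b0 i).
have Ia i : I (a i).
  apply: closedI; exists 2, (fun k => if k == 1%N then - b i else 0); split=> //.
    move=> [|[|[|//]]] // _; last exact: ideal0 (ideal_gen_ideal _).
    by rewrite ideal_exp1 //= -mulN1r; apply: IM; have [] := Hb i.
  rewrite big_nat_recr // big_nat1 /= mul0r addr0 expr1.
  apply: (axes_inj axesR) => j.
  rewrite rmorphD rmorphXn rmorphM rmorphN rmorph0 Ha.
  by case: eqP => [->|_]; rewrite ?expr2 ?mul0r ?mulr0 ?addr0 // mulNr subrr.
have [i|c _ Ec] := glue_origin axesR (g := fun i => chi i (b i)); first exact: b0.
have in_I z : (forall i, exists g, chi i z = chi i (b i) * g) -> I z.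
  move=> /choice [g Eg].
  have /choice [w Ew] i := diag_element axesR (g i).
  have -> : z = \sum_i w i * a i.
    apply: (axes_inj axesR) => i; rewrite rmorph_sum (bigD1 i) //= big1.
      by rewrite addr0 rmorphM Ha eqxx Ew Eg mulrC.
    move=> j; rewrite rmorphM Ha eq_sym => /negbTE ->.
    by rewrite mulr0.
  by elim/big_ind: _ => // i _; apply: IM.
have Ic : I c by apply: in_I => i; exists 1; rewrite mulr1.
exists 1%N, c; split=> //; rewrite [ideal_exp I 2]/(ideal_mul I (ideal_exp I 1)).
rewrite ideal_exp1 //; apply/seteqP; split; last first.
  by move=> _ [x Ix <-]; apply: ideal_mulP.
apply: ideal_gen_sub.
  split=> [|_ _ [x Ix <-] [y Iy <-]|d _ [x Ix <-]].
  - by exists 0; rewrite ?mulr0.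
  - by exists (x + y); rewrite ?mulrDr //; apply: ID.
  - by exists (d * x); [apply: IM|rewrite mulrCA].
move=> _ [x [y [Ix Iy ->]]].
have /choice [g Eg] i := (Hb i).2 x Ix; have /choice [h Eh] i := (Hb i).2 y Iy.
have [i|z _ Ez] := glue_origin axesR (g := fun i => chi i (b i) * (g i * h i)).
  by rewrite scoef0M b0 mul0r.
exists z; first by apply: in_I => i; exists (g i * h i).
by apply: (axes_inj axesR) => i; rewrite !rmorphM Ec Ez Eg Eh; ring.
Qed.

(** Outside its maximal ideal a ring of axes has only units, so that localizing
    there changes nothing. *)
Lemma axes_loc_max (M : set R) (hM : is_maximal M) : cm_local_dim1 (loc_max hM).
Proof.
pose S := prime_compl (maximal_prime hM).
have unitS x : mulset_set S x -> exists y, x * y = 1.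
  move=> Sx; apply: (axes_unit axesR); rewrite -(maximal_origin axesR hM).
  exact: Sx.
suff bij : bijective (@to_loc R S).
  have [chi' axes'] := is_axes_iso axesR bij.
  exact: axes_cm_local_dim1 axes'.
have inj : injective (@to_loc R S).
  move=> x y /loc_fracP [u /unitS [v uv]] /=; rewrite !mulr1 => E.
  by rewrite -[x]mul1r -uv mulrAC E mulrAC uv mul1r.
have /choice [g gK] (y : loc S) : exists x, to_loc S x = y.
  elim/loc_fracW: y => a s.
  have [v sv] := unitS _ (set_mem (proj2_sig s)).
  exists (a * v); apply/loc_fracP; exists 1; first exact: mulset_one.
  by rewrite /= !mul1r mulr1 -mulrA [v * _]mulrC sv mulr1.
by exists g => // x; apply: inj; rewrite gK.
Qed.

Lemma axes_arf : arf R.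
Proof.
split.
- exact: axes_noetherian axesR.
- exact: axes_semilocal axesR.
- exact: axes_loc_max.
- exact: axes_reduction.
- exact: axes_stable.
Qed.

End AxesArf.

(** * Power series in several variables *)

Section MultiSeries.
Variables (n : nat) (R : comNzRingType).
Implicit Types (f g : fps n R) (p q : {mpoly R[n]}) (m : 'X_{1..n}).

Lemma fcoefD f g m : fcoef (f + g) m = fcoef f m + fcoef g m. Proof. by []. Qed.
Lemma fcoef0 m : fcoef (0 : fps n R) m = 0. Proof. by []. Qed.

Definition ftrunc d f : {mpoly R[n]} :=
  \sum_(m : 'X_{1..n < d}) fcoef f m *: 'X_[m].

Lemma ftruncE d f m : (mdeg m < d)%N -> (ftrunc d f)@_m = fcoef f m.
Proof. exact: (mcoeff_mpoly (fcoef f)). Qed.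

Lemma fcoefM p q f g m :
  (forall k, (mdeg k <= mdeg m)%N -> p@_k = fcoef f k) ->
  (forall k, (mdeg k <= mdeg m)%N -> q@_k = fcoef g k) ->
  fcoef (f * g) m = (p * q)@_m.
Proof.
move=> Hp Hq; rewrite mcoeffM; apply: eq_bigr => k _.
by congr (_ * _); symmetry; [apply: Hp|apply: Hq]; rewrite -ltnS; apply: bmdeg.
Qed.

Lemma fcoef_varM i f m :
  fcoef (fps_var R i * f) m = if m i == 0%N then 0 else fcoef f (m - U_(i))%MM.
Proof.
rewrite (@fcoefM 'X_i (ftrunc (mdeg m).+1 f)); last first.
- by move=> k le_k; rewrite ftruncE.
- by move=> k _; rewrite mcoeffX eq_sym.
case: eqP => [m0|/eqP nz]; last first.
  have E : m = (U_(i) + (m - U_(i)))%MM.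
    rewrite addmC submK //; apply/mnm_lepP => j; rewrite mnm1E.
    by case: eqP => // <-; rewrite lt0n.
  by rewrite mulrC [X in _@_X]E mcoeffMX ftruncE // ltnS mdegB.
rewrite mcoeffM big1 // => k /eqP Ek; rewrite mcoeffX.
case: eqP => [E|]; last by rewrite mul0r.
by have := congr1 (fun v : 'X_{1..n} => v i) Ek; rewrite m0 -E mnmDE mnm1E eqxx.
Qed.

(** * Evaluation along the line through a point *)

Section LineEval.
Variables (S : comNzRingType) (h : {rmorphism R -> S}) (c : 'I_n -> S).

Let line_poly : {mpoly R[n]} -> {poly S} :=
  mmap (polyC \o h) (fun i => c i *: 'X).

Let mmap1_line m : mmap1 (fun i => c i *: 'X) m =
  (\prod_(i < n) c i ^+ m i) *: 'X^(mdeg m) :> {poly S}.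
Proof.
rewrite /mmap1; under eq_bigr do rewrite exprZn.
by rewrite scaler_prod mdegE -prodrXr.
Qed.

Let line_poly_coef p q d : (forall m, mdeg m = d -> p@_m = q@_m) ->
  (line_poly p)`_d = (line_poly q)`_d.
Proof.
move=> E; apply/eqP; rewrite -subr_eq0 -coefB -rmorphB; apply/eqP.
rewrite /line_poly /mmap coef_sum big1 // => m _.
rewrite mmap1_line /= mul_polyC !coefZ coefXn eq_sym.
case: eqP => [dm|]; last by rewrite !mulr0.
by rewrite mcoeffB E // subrr rmorph0 mul0r.
Qed.

(** The image of f under X_i |-> c_i T. Its coefficient of T^d involves only the
    part of degree d of f, hence can be read off any polynomial that agrees with
    f in that degree. *)
Definition line f : series S :=
  Series (fun d => (line_poly (ftrunc d.+1 f))`_d).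

Let lineE p f d : (forall m, mdeg m = d -> p@_m = fcoef f m) ->
  scoef (line f) d = (line_poly p)`_d.
Proof. by move=> E; apply: line_poly_coef => m dm; rewrite E // ftruncE ?dm. Qed.

Fact line_zmod_morphism : zmod_morphism line.
Proof.
move=> f g; apply: seriesP => d /=; rewrite -coefB -rmorphB.
by apply: line_poly_coef => m dm; rewrite mcoeffB !ftruncE ?dm.
Qed.

Fact line_monoid_morphism : monoid_morphism line.
Proof.
split=> [|f g]; apply: seriesP => d.
  rewrite (@lineE 1) => [|m _]; last by rewrite mcoeff1.
  by rewrite /line_poly rmorph1 coef1 scoef1.
have low u e : (e <= d)%N -> scoef (line u) e = (line_poly (ftrunc d.+1 u))`_e.
  by move=> le_e; apply: lineE => m dm; rewrite ftruncE // dm ltnS.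
rewrite (@lineE (ftrunc d.+1 f * ftrunc d.+1 g)).
  rewrite [in LHS]/line_poly rmorphM coefM scoefM; apply: eq_bigr => i _.
  by rewrite !low ?leq_subr // -ltnS.
move=> m dm; symmetry; apply: fcoefM => j le_j;
  by rewrite ftruncE // ltnS -dm.
Qed.

HB.instance Definition _ :=
  GRing.isZmodMorphism.Build (fps n R) (series S) line line_zmod_morphism.
HB.instance Definition _ :=
  GRing.isMonoidMorphism.Build (fps n R) (series S) line line_monoid_morphism.

Lemma line_var i : line (fps_var R i) = series_const (c i) * serT.
Proof.
apply: seriesP => d; rewrite (@lineE 'X_i) => [|m _]; last first.
  by rewrite mcoeffX eq_sym.
by rewrite /line_poly mmapX mmap1U coefZ coefX scoefCM.
Qed.

Lemma line_const a : line (fps_const n a) = series_const (h a).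
Proof.
apply: seriesP => d; rewrite (@lineE a%:MP) => [|m _]; last first.
  by rewrite mcoeffC mulr_natr.
by rewrite /line_poly mmapC coefC /=; case: d.
Qed.

Lemma line_coef0 f : scoef (line f) 0 = h (fcoef f 0%MM).
Proof.
rewrite (@lineE (fcoef f 0%MM)%:MP) => [|m /eqP]; last first.
  by rewrite mdeg_eq0 => /eqP ->; rewrite mcoeffC eqxx mulr1.
by rewrite /line_poly mmapC coefC.
Qed.

End LineEval.

(** * Sums that converge in the topology of one variable *)

Section VarSum.
Variable i : 'I_n.
Implicit Types (u v : nat -> fps n R).
Local Notation X := (fps_var R i).

(** The series \sum_d X_i^d u_d. *)
Definition var_sum u : fps n R :=
  Fps (fun m => \sum_(d < (m i).+1) fcoef (u d) (m - U_(i) *+ d)%MM).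

Lemma var_sumE u : var_sum u = u 0%N + X * var_sum (fun d => u d.+1).
Proof.
apply: fpsP => m; rewrite fcoefD fcoef_varM [LHS]big_ord_recl mulm0n subm0.
congr (_ + _); case: eqP => [->|/eqP nz]; first by rewrite big_ord0.
rewrite /= mnmBE mnm1E eqxx subn1 prednK ?lt0n //.
apply: eq_bigr => d _; congr (fcoef _ _).
by rewrite /bump add1n mulmS submDA.
Qed.

(** No nonzero series is divisible by every power of X_i. *)
Lemma var_separated u : (forall d, u d = X * u d.+1) -> forall d, u d = 0.
Proof.
move=> E d; apply: fpsP => m; have [N] := ubnP (m i).
elim: N m d => // N IH m d lt_m; rewrite E fcoef_varM.
case: eqP => // /eqP nz; apply: IH.
by rewrite mnmBE mnm1E eqxx subn1 -ltnS prednK // lt0n.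
Qed.

(** Both sides satisfy the recursion of [var_sumE], so that their difference is
    divisible by every power of X_i. *)
Lemma var_sumM u g : var_sum (fun d => u d * g) = var_sum u * g.
Proof.
pose w d := var_sum (fun e => u (d + e)%N * g) - var_sum (fun e => u (d + e)%N) * g.
have shift (v : nat -> fps n R) d :
    var_sum (fun e => v (d + e)%N) = v d + X * var_sum (fun e => v (d.+1 + e)%N).
  rewrite var_sumE addn0; congr (_ + X * _); congr var_sum.
  by apply: funext => e; rewrite addnS.
have /(_ 0%N)/eqP : forall d, w d = 0.
  apply: var_separated => d; rewrite /w (shift u).
  by rewrite (shift (fun e => u e * g)); ring.
by rewrite subr_eq0 => /eqP.
Qed.

Lemma var_sumD u v : var_sum (fun d => u d + v d) = var_sum u + var_sum v.
Proof. by apply: fpsP => m; rewrite fcoefD /= -big_split. Qed.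

End VarSum.

End MultiSeries.

(** * The ideal of minors *)

Section Minors.
Variable k : fieldType.
Local Notation U := (serU k).
Local Notation X := (varX k).
Local Notation Y := (varY k).
Local Notation Z := (varZ k).
Local Notation C := (fps_const 3).
Local Notation a := (@minors_ideal k).

Lemma minors_idealP : is_ideal a.
Proof. exact: ideal_gen_ideal. Qed.

Lemma minors_matXYZ (d : U) :
  minors 2 (matXYZ k) d <->
  [\/ d = X * Z - Y * Y, d = X * X - Z * Y | d = Y * X - Z * Z].
Proof.
split=> [[f [g [incf incg ->]]]|H].
  have := incf 0 1 isT; have lt_g := incg 0 1 isT.
  rewrite det_mx2 ![mxsub _ _ _ _ _]mxE !mxE.
  case: (f 0) => [[|[|//]] ?]; case: (f 1) => [[|[|//]] ?] //.
  have cols (j1 j2 : 'I_3) : (j1 < j2)%N ->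
      [\/ (j1 = 0%N :> nat /\ j2 = 1%N :> nat), (j1 = 0%N :> nat /\ j2 = 2%N :> nat)
        | (j1 = 1%N :> nat /\ j2 = 2%N :> nat)].
    case: j1 j2 => [[|[|[|//]]] ?] [[|[|[|//]]] ?] // _;
      by [apply: Or31|apply: Or32|apply: Or33].
  move=> _; case: (cols _ _ lt_g) => -[-> ->].
  - by cbn [nth nat_of_ord]; apply: Or31.
  - by cbn [nth nat_of_ord]; apply: Or32.
  - by cbn [nth nat_of_ord]; apply: Or33.
have det (j1 j2 : 'I_3) : (j1 < j2)%N ->
    minors 2 (matXYZ k) (matXYZ k 0 j1 * matXYZ k 1 j2 - matXYZ k 0 j2 * matXYZ k 1 j1).
  move=> lt_j; exists id, (fun i : 'I_2 => if i == 0 then j1 else j2); split=> //.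
    by move=> [[|[|//]] ?] [[|[|//]] ?].
  by rewrite det_mx2 ![mxsub _ _ _ _ _]mxE.
case: H => ->.
- by have := det (@Ordinal 3 0 isT) (@Ordinal 3 1 isT) isT; rewrite !mxE.
- by have := det (@Ordinal 3 0 isT) (@Ordinal 3 2 isT) isT; rewrite !mxE.
- by have := det (@Ordinal 3 1 isT) (@Ordinal 3 2 isT) isT; rewrite !mxE.
Qed.

Lemma minors_gens : [/\ a (X * Z - Y * Y), a (X * X - Z * Y) & a (Y * X - Z * Z)].
Proof.
by split; apply: sub_ideal_gen; apply/minors_matXYZ;
  [apply: Or31|apply: Or32|apply: Or33].
Qed.

Lemma split_variables (f : U) :
  exists c u v w, f = C c + X * u + Y * v + Z * w.
Proof.
pose i0 : 'I_3 := @Ordinal 3 0 isT; pose i1 : 'I_3 := @Ordinal 3 1 isT.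
pose i2 : 'I_3 := @Ordinal 3 2 isT.
exists (fcoef f 0%MM), (Fps (fun m => fcoef f (m + U_(i0))%MM)),
  (Fps (fun m => if m i0 == 0%N then fcoef f (m + U_(i1))%MM else 0)),
  (Fps (fun m => if (m i0 == 0%N) && (m i1 == 0%N) then fcoef f (m + U_(i2))%MM else 0)).
apply: fpsP => m; rewrite !fcoefD !fcoef_varM -/i0 -/i1 -/i2 /=.
have sK i : m i != 0%N -> (m - U_(i) + U_(i))%MM = m.
  move=> nz; rewrite submK //; apply/mnm_lepP => j; rewrite mnm1E.
  by case: eqP => // <-; rewrite lt0n.
rewrite !mnmBE !mnm1E /= !subn0.
have [m0|n0] := eqVneq (m i0) 0%N; last first.
  rewrite sK // [m == 0%MM](_ : _ = false) ?mulr0n ?add0r ?if_same ?addr0 //.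
  by apply: contraNF n0 => /eqP ->; rewrite mnm0E.
have [m1|n1] := eqVneq (m i1) 0%N; last first.
  rewrite sK // [m == 0%MM](_ : _ = false) ?mulr0n ?add0r ?if_same ?addr0 //.
  by apply: contraNF n1 => /eqP ->; rewrite mnm0E.
have [m2|n2] := eqVneq (m i2) 0%N; last first.
  rewrite sK // [m == 0%MM](_ : _ = false) ?mulr0n ?add0r ?if_same ?addr0 //.
  by apply: contraNF n2 => /eqP ->; rewrite mnm0E.
suff -> : m = 0%MM by rewrite eqxx !addr0.
apply/mnmP => -[[|[|[|//]]] lti]; rewrite mnm0E;
  [rewrite -[RHS]m0|rewrite -[RHS]m1|rewrite -[RHS]m2];
  by congr (m _); apply: val_inj.
Qed.

Let q1 : U := X * Z - Y * Y.
Let q2 : U := X * X - Z * Y.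
Let q3 : U := Y * X - Z * Z.

(** Modulo the minors the maximal ideal M of U satisfies M^2 = X M, so only the
    linear terms in Y and Z cannot be absorbed in a multiple of X. *)
Lemma minors_step (f : U) : exists e : k * k * k * (U * U * U * U),
  let: (c0, c1, c2, (g, u, v, w)) := e in
  f = C c0 + C c1 * Y + C c2 * Z + X * g + u * q1 + v * q2 + w * q3.
Proof.
have [c0 [u [v [w ->]]]] := split_variables f.
have [c1 [v0 [v1 [v2 ->]]]] := split_variables v.
have [c2 [w0 [w1 [w2 ->]]]] := split_variables w.
exists (c0, c1, c2, (u + Y * v0 + Z * v1 + X * v2 + Z * w0 + X * w1 + Y * w2,
  - v1, - (v2 + w1), - w2)).
by rewrite /q1 /q2 /q3; ring.
Qed.

Definition in_X (s : nat -> k) : U := var_sum (@Ordinal 3 0 isT) (fun d => C (s d)).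

(** U / a is generated by 1, Y, Z over k[[X]]: iterate [minors_step] and sum the
    resulting X-adically convergent series. *)
Lemma minors_division (f : U) : exists s0 s1 s2 : nat -> k,
  a (f - (in_X s0 + in_X s1 * Y + in_X s2 * Z)).
Proof.
have /choice [F HF] := minors_step.
pose step g := (F g).2.1.1.1; pose it d := iter d step f.
pose s0 d := (F (it d)).1.1.1; pose s1 d := (F (it d)).1.1.2.
pose s2 d := (F (it d)).1.2.
pose u d := (F (it d)).2.1.1.2; pose v d := (F (it d)).2.1.2.
pose w d := (F (it d)).2.2.
pose sum := var_sum (R := k) (@Ordinal 3 0 isT).
have E d : it d = C (s0 d) + C (s1 d) * Y + C (s2 d) * Z + X * it d.+1
                  + u d * q1 + v d * q2 + w d * q3.
  have := HF (it d); rewrite /s0 /s1 /s2 /u /v /w [it d.+1]/(step (it d)) /step.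
  by case: (F (it d)) => [[[? ?] ?] [[[? ?] ?] ?]].
have sumX : sum it = f + X * sum (fun d => it d.+1).
  by rewrite /sum {1}var_sumE.
have sumE : sum it = in_X s0 + in_X s1 * Y + in_X s2 * Z
    + X * sum (fun d => it d.+1) + sum u * q1 + sum v * q2 + sum w * q3.
  have -> : sum it = sum (fun d => C (s0 d) + C (s1 d) * Y + C (s2 d) * Z
      + it d.+1 * X + u d * q1 + v d * q2 + w d * q3).
    by congr sum; apply: funext => d; rewrite [it d.+1 * X]mulrC; exact: E.
  by rewrite /sum !var_sumD !var_sumM -/sum -[X * _]mulrC.
exists s0, s1, s2.
have -> : f - (in_X s0 + in_X s1 * Y + in_X s2 * Z) =
    sum u * q1 + sum v * q2 + sum w * q3.
  apply/eqP; rewrite subr_eq -(inj_eq (addIr (X * sum (fun d => it d.+1)))).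
  by rewrite -sumX sumE; apply/eqP; ring.
have [_ ID IM] := minors_idealP; have [g1 g2 g3] := minors_gens.
exact: (ID _ _ (ID _ _ (IM _ _ g1) (IM _ _ g2)) (IM _ _ g3)).
Qed.

(** The three lines cut out by a, seen at once: X |-> T, Y |-> y T, Z |-> y^2 T,
    where the parameter y of the lines is to be taken modulo y^3 - 1. *)
Definition cone : {rmorphism U -> series {poly k}} :=
  line (polyC : {rmorphism k -> {poly k}}) (fun i : 'I_3 => 'X ^+ i).

Lemma cone_const c : cone (C c) = series_const c%:P.
Proof. exact: line_const. Qed.

Lemma cone_varX : cone X = serT.
Proof.
apply: etrans (line_var _ _ _) _; apply: seriesP => d.
by rewrite scoefCM mul1r.
Qed.

Lemma cone_varY : cone Y = serT * series_const 'X.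
Proof. by apply: etrans (line_var _ _ _) _; rewrite mulrC expr1. Qed.

Lemma cone_varZ : cone Z = serT * series_const 'X^2.
Proof. by apply: etrans (line_var _ _ _) _; rewrite mulrC. Qed.

Lemma cone_in_X s d : scoef (cone (in_X s)) d = (s d)%:P.
Proof.
have rec r : cone (in_X r) =
    series_const (r 0%N)%:P + serT * cone (in_X (fun e => r e.+1)).
  by rewrite -cone_varX -cone_const -rmorphM -rmorphD {1}/in_X var_sumE.
elim: d s => [|d IH] s; rewrite rec scoefD scoefTM scoefC; first by rewrite addr0.
by rewrite IH add0r.
Qed.

Lemma cone_normal s0 s1 s2 d :
  scoef (cone (in_X s0 + in_X s1 * Y + in_X s2 * Z)) d =
    (s0 d)%:P + (if d is e.+1 then (s1 e)%:P * 'X + (s2 e)%:P * 'X^2 else 0).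
Proof.
have shifted s p : scoef (cone (in_X s) * (serT * series_const p)) d =
    if d is e.+1 then (s e)%:P * p else 0.
  rewrite mulrCA scoefTM; case: d => // e.
  by rewrite mulrC scoefCM cone_in_X mulrC.
rewrite !rmorphD !rmorphM cone_varY cone_varZ !scoefD cone_in_X !shifted -addrA.
by case: d {shifted} => [|d]; rewrite ?addr0.
Qed.

Lemma cone_coef0 f : scoef (cone f) 0 = (fcoef f 0%MM)%:P.
Proof. exact: line_coef0. Qed.

Lemma dvdp_cubic_small (c0 c1 c2 : k) :
  'X^3 - 1 %| c0%:P + (c1%:P * 'X + c2%:P * 'X^2) ->
  [/\ c0 = 0, c1 = 0 & c2 = 0].
Proof.
set p := c0%:P + _ => dvd_p.
have pE : p = Poly [:: c0; c1; c2].
  by rewrite /p /= !cons_poly_def; ring.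
have p0 : p = 0.
  apply/eqP; apply: contraLR dvd_p => nz; apply/negP => /(dvdp_leq nz).
  by rewrite size_XnsubC // pE leqNgt ltnS (leq_trans (size_Poly _)).
have c i : p`_i = [:: c0; c1; c2]`_i by rewrite pE coef_Poly.
by move: (c 0%N) (c 1%N) (c 2%N); rewrite p0 !coef0.
Qed.

(** A remainder of [minors_division] is determined by its image in the cone:
    the polynomials of degree at most 2 in y are reduced modulo y^3 - 1. *)
Theorem minors_idealE (f : U) :
  a f <-> forall d, 'X^3 - 1 %| scoef (cone f) d.
Proof.
pose J : set U := [set g | forall d, 'X^3 - 1 %| scoef (cone g) d].
have HJ : is_ideal J.
  split=> [d|g h Jg Jh d|g h Jh d].
  - by rewrite rmorph0 dvdp0.
  - rewrite rmorphD scoefD; exact: dvdp_add (Jg d) (Jh d).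
  - rewrite rmorphM scoefM; elim/big_ind: _ => [|p q|i _]; first exact: dvdp0.
      exact: dvdp_add.
    exact: dvdp_mull.
have aJ : a `<=` J.
  apply: ideal_gen_sub => // g /minors_matXYZ gE d.
  pose y : series {poly k} := series_const 'X.
  have [r ->] : exists r, cone g = series_const ('X^3 - 1) * r.
    have -> : series_const ('X^3 - 1) = y ^+ 3 - 1.
      by rewrite series_constB series_const1 !exprS !expr0 !mulr1 !series_constM -/y.
    have EX := cone_varX; have EY := cone_varY; have EZ := cone_varZ.
    rewrite expr2 series_constM -/y in EY EZ.
    case: gE => ->; rewrite rmorphB !rmorphM EX ?EY ?EZ.
    - by exists 0; ring.
    - by exists (- serT ^+ 2); ring.
    - by exists (- serT ^+ 2 * y); ring.
  by rewrite scoefCM dvdp_mulr.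
split=> [/aJ //|Jf].
have [s0 [s1 [s2 Hs]]] := minors_division f.
set g := in_X s0 + _ + _ in Hs.
have Jg d : 'X^3 - 1 %| scoef (cone g) d.
  by have : J g by rewrite -[g](subKr f); exact: (idealB HJ Jf (aJ _ Hs)).
suff g0 : g = 0 by rewrite g0 subr0 in Hs.
have s00 d : s0 d = 0.
  have := Jg d; rewrite cone_normal; case: d => [|d] => [|/dvdp_cubic_small [] //].
  have -> : (s0 0%N)%:P + 0 = (s0 0%N)%:P + (0%:P * 'X + 0%:P * 'X^2).
    by rewrite polyC0 !mul0r !addr0.
  by case/dvdp_cubic_small.
have [s10 s20] : (forall d, s1 d = 0) /\ (forall d, s2 d = 0).
  by split=> d; have := Jg d.+1; rewrite cone_normal => /dvdp_cubic_small [].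
have in0 s : (forall d, s d = 0) -> in_X s = 0.
  move=> s_0; apply: fpsP => m; rewrite fcoef0 /= big1 // => d _.
  by rewrite /= s_0 mul0rn.
by rewrite /g !in0 // !mul0r !addr0.
Qed.

End Minors.

(** * The ring A *)

Section RingA.
Variable k : fieldType.
Local Notation U := (serU k).
Local Notation A := (ringA k).
Local Notation X := (varX k).
Local Notation Y := (varY k).
Local Notation Z := (varZ k).
Local Notation a := (@minors_ideal k).

Local Notation cone := (cone k).

Definition ringA_pi : {rmorphism U -> A} :=
  (\pi_({ideal_quot (minors_idealr k)}) : {rmorphism U -> _})%qT.

Lemma ringA_pi_eq f g : ringA_pi f = ringA_pi g <-> a (f - g).
Proof.
have E : (f - g \in minors_idealr k) = (ringA_pi f == ringA_pi g).
  exact: Quotient.idealrBE.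
split=> [/eqP|H]; first by rewrite -E => /set_mem.
by apply/eqP; rewrite -E; apply/mem_set.
Qed.

Lemma ringA_pi_eq0 f : ringA_pi f = 0 <-> a f.
Proof. by rewrite -(rmorph0 ringA_pi) ringA_pi_eq subr0. Qed.

Lemma ringA_pi_surj x : exists f, ringA_pi f = x.
Proof. exists (repr (x : {ideal_quot (minors_idealr k)})); exact: reprK. Qed.

Lemma ringA_lift (S : comNzRingType) (h : {rmorphism U -> S}) :
  (forall f, a f -> h f = 0) ->
  exists g : {rmorphism A -> S}, forall f, g (ringA_pi f) = h f.
Proof.
move=> h0; have /choice [r rK] := ringA_pi_surj.
pose g x := h (r x).
have gE f : g (ringA_pi f) = h f.
  apply/eqP; rewrite -subr_eq0 -rmorphB; apply/eqP/h0/ringA_pi_eq.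
  by rewrite rK.
have gA : zmod_morphism g.
  move=> x y; have [[f <-] [f' <-]] := (ringA_pi_surj x, ringA_pi_surj y).
  by rewrite -rmorphB !gE rmorphB.
have gM : monoid_morphism g.
  split=> [|x y]; first by rewrite -(rmorph1 ringA_pi) gE rmorph1.
  have [[f <-] [f' <-]] := (ringA_pi_surj x, ringA_pi_surj y).
  by rewrite -rmorphM !gE rmorphM.
pose gA' := GRing.isZmodMorphism.Build A S g gA.
pose gM' := GRing.isMonoidMorphism.Build A S g gM.
pose g' : {rmorphism A -> S} := HB.pack g gA' gM'.
by exists g'.
Qed.

Lemma varX_lreg : GRing.lreg (ringA_pi X).
Proof.
move=> x y; have [[f <-] [g <-]] := (ringA_pi_surj x, ringA_pi_surj y).
rewrite -!rmorphM => /ringA_pi_eq; rewrite -mulrBr => /minors_idealE H.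
apply/ringA_pi_eq/minors_idealE => d; have := H d.+1.
by rewrite rmorphM cone_varX scoefTM.
Qed.

(** * Characteristic 3 *)

Lemma integral_nilpotent (R : comNzRingType) (x y : R) (hx : GRing.lreg x) n :
  y ^+ n = 0 -> integralOver (@to_total_frac R) (tfrac y hx).
Proof.
move=> yn; exists 'X^n; first exact: monicXn.
rewrite rmorphXn /= map_polyX rootE hornerXn; apply/eqP.
have inv : tfrac 1 hx * to_total_frac x = 1 by rewrite tfracK rmorph1.
suff : tfrac y hx ^+ n * to_total_frac x ^+ n = 0.
  move/(congr1 ( *%R^~ (tfrac 1 hx ^+ n))).
  by rewrite mul0r -mulrA -exprMn [_ * tfrac 1 hx]mulrC inv expr1n mulr1.
by rewrite -exprMn tfracK -rmorphXn yn rmorph0.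
Qed.

(** In the cone (X - Y)^3 is T^3 (1 - y)^3 = - T^3 (y^3 - 1). *)
Lemma cone_pchar3 : 3%N \in [pchar k] -> a ((X - Y) ^+ 3).
Proof.
move=> char3; apply/minors_idealE => d.
pose y : series {poly k} := series_const 'X.
have three : 3%:R = 0 :> series {poly k}.
  have p3 : 3%:R = 0 :> {poly k} by rewrite -(rmorph_nat polyC) (pcharf0 char3) rmorph0.
  apply: seriesP => e; transitivity ((e == 0%N)%:R * 3%:R : {poly k}).
    by rewrite mulr_natr.
  by rewrite p3 mulr0.
have -> : cone ((X - Y) ^+ 3) = series_const ('X^3 - 1) * - serT ^+ 3.
  rewrite rmorphXn rmorphB cone_varX cone_varY -/y.
  rewrite series_constB series_const1 !exprS !expr0 !mulr1 !series_constM -/y.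
  apply/eqP; rewrite -subr_eq0 -[X in _ == X](mul0r (serT ^+ 3 * (y * y - y))) -three.
  by apply/eqP; ring.
by rewrite scoefCM dvdp_mulr.
Qed.

(** Take the fractions y / x and z / x of the second Arf condition both equal to
    (X - Y) / X^2, which is nilpotent. The condition would put (X - Y)^2 / X^2 in A,
    and its restriction (1 - y)^2 to the cone would be constant modulo y^3 - 1. *)
Lemma ringA_pchar3 : 3%N \in [pchar k] -> ~ arf A.
Proof.
move=> char3 arfA.
have regX2 : GRing.lreg (ringA_pi X * ringA_pi X) by apply: lregM; exact: varX_lreg.
have intXY : integralOver (@to_total_frac A) (tfrac (ringA_pi (X - Y)) regX2).
  apply: (@integral_nilpotent _ _ _ _ 3); rewrite -rmorphXn; apply/ringA_pi_eq0.
  exact: cone_pchar3.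
have [w] := arf_stable arfA intXY intXY; have [f <-] := ringA_pi_surj w.
rewrite tfrac_eq -!rmorphM => /ringA_pi_eq /minors_idealE /(_ 2%N).
have -> : cone ((X - Y) * (X - Y) - X * X * f) =
    serT * (serT * (series_const ((1 - 'X) * (1 - 'X)) - cone f)).
  rewrite rmorphB !rmorphM rmorphB cone_varX cone_varY.
  by rewrite series_constM series_constB series_const1; ring.
rewrite !scoefTM scoefD scoefN scoefC cone_coef0; set c := fcoef f 0%MM.
have -> : (1 - 'X) * (1 - 'X) - c%:P =
    (1 - c)%:P + ((- 2%:R)%:P * 'X + 1%:P * 'X^2) :> {poly k}.
  by rewrite !rmorphB rmorphN rmorph1 rmorph_nat; ring.
by case/dvdp_cubic_small => _ _ /eqP; rewrite oner_eq0.
Qed.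

(** * Three distinct cube roots of unity *)

Section CubeRoots.
Variable alpha : k.
Hypotheses (three_neq0 : 3%:R != 0 :> k).
Hypotheses (alpha_neq1 : alpha != 1) (alpha3 : alpha ^+ 3 = 1).

Lemma alpha_prim : 3.-primitive_root alpha.
Proof.
have [m prim_m dvd_m] := prim_order_exists (isT : (0 < 3)%N) alpha3.
have : m \in [:: 1; 3]%N by rewrite (dvdn_divisors) in dvd_m.
rewrite !inE => /orP [] /eqP Em; rewrite Em // in prim_m *.
by case/eqP: alpha_neq1; rewrite -[alpha]expr1 prim_expr_order.
Qed.

Lemma dvdp_cubic_roots (p : {poly k}) :
  (forall j : 'I_3, p.[alpha ^+ j] = 0) -> 'X^3 - 1 %| p.
Proof.
move=> p0; have [q ->] : exists q, p = q * ('X^3 - 1); last exact: dvdp_mull.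
rewrite -(factor_Xn_sub_1 alpha_prim) -(big_map (fun i => alpha ^+ i) xpredT
  (fun z => 'X - z%:P)).
apply: uniq_roots_prod_XsubC; last first.
  rewrite uniq_rootsE map_inj_in_uniq ?iota_uniq // => i j.
  rewrite !mem_index_iota => lti ltj /eqP.
  by rewrite (eq_prim_root_expr alpha_prim) !modn_small // => /eqP.
apply/allP => z /mapP [i]; rewrite mem_index_iota => lti ->.
by rewrite rootE (p0 (Ordinal lti)).
Qed.

(** Discrete Fourier inversion on the group of cube roots of unity. *)
Lemma fourier3 (v0 v1 v2 : k) : exists c0 c1 c2, 
  [/\ v0 = c0 + (c1 + c2),
      v1 = c0 + (c1 * alpha + c2 * alpha ^+ 2)
    & v2 = c0 + (c1 * alpha ^+ 2 + c2 * (alpha ^+ 2) ^+ 2)].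
Proof.
have S0 : 1 + alpha + alpha ^+ 2 = 0.
  apply: (mulfI (_ : alpha - 1 != 0)); first by rewrite subr_eq0.
  by transitivity (alpha ^+ 3 - 1); [ring|rewrite alpha3 subrr mulr0].
(* In each of the three identities below the difference of the two sides is a
   multiple of 1 + alpha + alpha^2. *)
exists ((v0 + v1 + v2) / 3%:R), ((v0 + alpha ^+ 2 * v1 + alpha * v2) / 3%:R),
  ((v0 + alpha * v1 + alpha ^+ 2 * v2) / 3%:R).
split; apply/eqP; rewrite eq_sym -subr_eq0; apply/eqP.
- transitivity ((v1 + v2) / 3%:R * (1 + alpha + alpha ^+ 2)); last by rewrite S0 mulr0.
  by field.
- transitivity ((v0 + 2%:R * (alpha - 1) * v1 + v2 * (1 + alpha * (alpha - 1))) / 3%:R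
    * (1 + alpha + alpha ^+ 2)); last by rewrite S0 mulr0.
  by field.
- transitivity ((v0 * (1 + alpha ^+ 2 - alpha) + v1 * (1 + (alpha - 1) * (alpha + alpha ^+ 2))
    + v2 * (alpha - 1) * (2%:R + alpha ^+ 3)) / 3%:R
    * (1 + alpha + alpha ^+ 2)); last by rewrite S0 mulr0.
  by field.
Qed.

(** The restriction to the line (1 : alpha^j : alpha^2j). *)
Definition branch (j : 'I_3) : {rmorphism U -> series k} :=
  series_map (horner_eval (alpha ^+ j)) \o cone.

Lemma branchE j f d : scoef (branch j f) d = (scoef (cone f) d).[alpha ^+ j].
Proof. by []. Qed.

(** Injectivity holds because y^3 - 1 is the product of the y - alpha^j, and a
    triple of series is reached by interpolating its coefficients, degree by
    degree, by polynomials of degree at most 2 in y. *)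
Lemma ringA_is_axes :
  exists chi : 'I_3 -> {rmorphism A -> series k}, is_axes chi.
Proof.
have /choice [chi chiE] : forall j, exists g : {rmorphism A -> series k},
    forall f, g (ringA_pi f) = branch j f.
  move=> j; apply: ringA_lift => f /minors_idealE fa; apply: seriesP => d.
  have /dvdpP [q] := fa d; rewrite branchE => ->.
  by rewrite hornerM !hornerE exprAC alpha3 expr1n subrr mulr0.
exists chi; split.
- move=> x y; have [[f <-] [g <-]] := (ringA_pi_surj x, ringA_pi_surj y) => E.
  apply/ringA_pi_eq/minors_idealE => d; apply: dvdp_cubic_roots => j.
  by rewrite -branchE rmorphB scoefD scoefN -!chiE E subrr.
- move=> x i j; have [f <-] := ringA_pi_surj x.
  by rewrite !chiE !branchE !cone_coef0 !hornerC.
- move=> g Eg.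
  have [c0 [c1 [c2 Ec]]] : exists c0 c1 c2 : nat -> k, forall d j,
      scoef (g j) d = c0 d + (c1 d * alpha ^+ j + c2 d * (alpha ^+ j) ^+ 2).
    have /choice [c0 /choice [c1 /choice [c2 Ec]]] := fun d =>
      fourier3 (scoef (g (@Ordinal 3 0 isT)) d) (scoef (g (@Ordinal 3 1 isT)) d)
        (scoef (g (@Ordinal 3 2 isT)) d).
    exists c0, c1, c2 => d [[|[|[|//]]] ltj]; have [E0 E1 E2] := Ec d.
    - by rewrite (_ : Ordinal ltj = @Ordinal 3 0 isT) ?E0 ?expr0 ?expr1n ?mulr1 //; apply: val_inj.
    - by rewrite (_ : Ordinal ltj = @Ordinal 3 1 isT) ?E1 ?expr1 //; apply: val_inj.
    - by rewrite (_ : Ordinal ltj = @Ordinal 3 2 isT) ?E2 //; apply: val_inj.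
  (* The terms in Y and Z do not reach degree 0, where the three series agree. *)
  pose s0 d := if d is 0%N then scoef (g ord0) 0 else c0 d.
  pose f : U := in_X s0 + in_X (fun d => c1 d.+1) * Y + in_X (fun d => c2 d.+1) * Z.
  exists (ringA_pi f) => j; rewrite chiE; apply: seriesP => d.
  rewrite branchE cone_normal; case: d => [|d].
    by rewrite addr0 hornerC; exact: Eg.
  by rewrite Ec !hornerE.
Qed.

End CubeRoots.
End RingA.

(** * The theorem *)

Theorem theorem12p1 (k : fieldType) :
  (3%N \in [pchar k] -> ~ arf (ringA k)) /\
  (3%N \notin [pchar k] ->
   (exists alpha : k, alpha != 1 /\ alpha ^+ 3 = 1) ->
   arf (ringA k)).
Proof.
split; first exact: ringA_pchar3.
rewrite inE /= => three [alpha [alpha_neq1 alpha3]].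
have [chi axesA] := ringA_is_axes three alpha_neq1 alpha3.
exact: axes_arf axesA.
Qed.
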